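(* Let $X$ be an integral (Noetherian) Nagata scheme, and let $\nu\colon X^\nu\to X$ be its normalization map. Then the following are equivalent: (1) $X$ is normal; (2) $\operatorname{level}^{\mathbb{R}\nu_\ast\mathcal{O}_{X^\nu}}(\mathcal{O}_X)\leq 1$.
   Context: For a Noetherian scheme $X$, $D^b_{\operatorname{coh}}(X)$ is the strictly full subcategory of the derived category of $\mathcal{O}_X$-modules consisting of complexes with bounded and coherent cohomology. Let $\mathcal{T}$ be a triangulated category and $G$ an object. Let $\operatorname{add}(\mathcal{S})$ be the smallest strictly full subcategory of $\mathcal{T}$ containing $\mathcal{S}$ and closed under shifts, finite coproducts and direct summands. Put $\langle G\rangle_0=\operatorname{add}(0)$, $\langle G\rangle_1=\operatorname{add}(G)$, and $\langle G\rangle_n=\operatorname{add}\{\operatorname{cone}(\phi):\phi\in\operatorname{Hom}_{\mathcal{T}}(\langle G\rangle_{n-1},\langle G\rangle_1)\}$. The level $\operatorname{level}^{G}(E)$ of an object $E$ is the minimal $n\ge 0$ with $E\in\langle G\rangle_n$. The level here is taken in $\mathcal{T}=D^b_{\operatorname{coh}}(X)$. *)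

(* Defs.v *)
From HB Require Import structures.
From mathcomp Require Import all_boot all_order all_algebra all_field.
From mathcomp Require Import generic_quotient.
From mathcomp Require Import boolp classical_sets functions topology.

Set Implicit Arguments.
Unset Strict Implicit.
Unset Printing Implicit Defensive.

Import GRing.Theory.
Local Open Scope classical_set_scope.
Local Open Scope ring_scope.
Local Open Scope quotient_scope.

(* Rings are comPzRingType's throughout, because the sections of a sheaf of   *)
(* rings over the empty open form the zero ring.                              *)

Section CommutativeAlgebra.

Definition invertible (A : comPzRingType) (a : A) := exists b, a * b = 1.

Definition local_ring (A : comPzRingType) :=
  (1 : A) <> 0 /\
  forall a b : A, invertible (a + b) -> invertible a \/ invertible b.

Definition integral_domain (A : comPzRingType) :=
  (1 : A) <> 0 /\ forall a b : A, a * b = 0 -> a = 0 \/ b = 0.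

Definition is_ideal (A : comPzRingType) (I : set A) :=
  [/\ I 0, forall a b, I a -> I b -> I (a + b) & forall a b, I b -> I (a * b)].

Definition prime_ideal (A : comPzRingType) (P : set A) :=
  [/\ is_ideal P, ~ P 1 & forall a b, P (a * b) -> P a \/ P b].

Definition noetherian_ring (A : comPzRingType) :=
  forall I : set A, is_ideal I ->
  exists n (g : 'I_n -> A),
    I = [set a | exists c : 'I_n -> A, a = \sum_(i < n) c i * g i].

Definition is_localization (A B : comPzRingType) (f : A)
    (phi : {rmorphism A -> B}) :=
  [/\ invertible (phi f),
      forall b, exists n a, phi f ^+ n * b = phi a
    & forall a, phi a = 0 -> exists n, f ^+ n * a = 0].

Definition integral_over (A B : comPzRingType) (phi : {rmorphism A -> B})
    (y : B) :=
  exists n (c : 'I_n -> A), y ^+ n + \sum_(i < n) phi (c i) * y ^+ i = 0.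

Definition fractions_of (A : comPzRingType) (K : fieldType)
    (phi : {rmorphism A -> K}) :=
  forall y, exists a b, phi b != 0 /\ y = phi a / phi b.

Definition normal_domain (A : comPzRingType) :=
  integral_domain A /\
  forall (K : fieldType) (phi : {rmorphism A -> K}),
    injective phi -> fractions_of phi ->
    forall y, integral_over phi y -> exists a, y = phi a.

(* For every prime P, the domain A / P is N-2: K below is the fraction field  *)
(* of A / P, and the integral closure of A / P in every finite extension L of *)
(* K is a finitely generated module.                                          *)
Definition nagata_ring (A : comPzRingType) :=
  noetherian_ring A /\
  forall P : set A, prime_ideal P ->
  forall (K : fieldType) (phi : {rmorphism A -> K}),
    [set a | phi a = 0] = P -> fractions_of phi ->
  forall L : fieldExtType K,
  let psi : {rmorphism A -> L} := in_alg L \o phi in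
  exists n (e : 'I_n -> L),
    [set y | integral_over psi y] =
    [set y | exists c : 'I_n -> A, y = \sum_(i < n) psi (c i) * e i].

End CommutativeAlgebra.

Identity Coercion set_app : set >-> Funclass.

Record opens (X : topologicalType) := Opens {
  oset :> set X;
  open_oset : open oset }.

Section Opens.
Variable X : topologicalType.

Definition opensI (U V : opens X) : opens X :=
  Opens (openI (open_oset U) (open_oset V)).

Definition opensT : opens X := Opens (@openT X).

Definition covers (C : set (opens X)) (U : opens X) :=
  (forall V, C V -> V `<=` U) /\ U `<=` \bigcup_(V in C) (V : set X).

Definition locally_on (U : opens X) (P : forall V : opens X, V `<=` U -> Prop) :=
  forall x, U x -> exists (V : opens X) (h : V `<=` U), V x /\ P V h.

(* The family s is total for convenience; only its values on C matter. *)
Definition sheaf_axiom (F : opens X -> Type)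
    (res : forall U V : opens X, V `<=` U -> F U -> F V) :=
  forall (U : opens X) (C : set (opens X)) (s : forall V, F V),
  forall CU : covers C U,
  (forall (V V' W : opens X) (h : W `<=` V) (h' : W `<=` V'), C V -> C V' ->
     res V W h (s V) = res V' W h' (s V')) ->
  exists! t : F U, forall (V : opens X) (CV : C V), res U V (CU.1 V CV) t = s V.

End Opens.
Arguments opensT {X}.

Record ringSheaf (X : topologicalType) := RingSheaf {
  rsec :> opens X -> comPzRingType;
  rres : forall U V : opens X, V `<=` U -> {rmorphism rsec U -> rsec V};
  rres_id : forall (U : opens X) (h : U `<=` U) s, rres h s = s;
  rres_comp : forall (U V W : opens X) (h : V `<=` U) (k : W `<=` V)
    (l : W `<=` U) s, rres k (rres h s) = rres l s;
  rres_sheaf : @sheaf_axiom X rsec (fun U V h => rres h) }.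

Arguments rres {X r U V} h.

Section Stalk.
Variables (X : topologicalType) (O : ringSheaf X) (x : X).

Record germ_rep := GermRep {
  germ_open : opens X;
  germ_mem : germ_open x;
  germ_sec : O germ_open }.

HB.instance Definition _ := gen_eqMixin germ_rep.
HB.instance Definition _ := gen_choiceMixin germ_rep.

Definition germ_eq (a b : germ_rep) : bool :=
  `[< exists (W : opens X) (h : W `<=` germ_open a) (k : W `<=` germ_open b),
        W x /\ rres h (germ_sec a) = rres k (germ_sec b) >].

Lemma germ_eq_refl : reflexive germ_eq.
Proof.
move=> a; apply/asboolP; exists (germ_open a), (fun _ => id), (fun _ => id).
by split=> //; exact: germ_mem.
Qed.

Lemma germ_eq_sym : symmetric germ_eq.
Proof.
by move=> a b; apply/asboolP/asboolP => -[W [h [k [Wx e]]]]; exists W, k, h.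
Qed.

Lemma germ_eq_trans : transitive germ_eq.
Proof.
move=> b a c /asboolP[W [h [k [Wx e]]]] /asboolP[W' [h' [k' [Wx' e']]]].
have s1 : opensI W W' `<=` W by move=> y [].
have s2 : opensI W W' `<=` W' by move=> y [].
apply/asboolP; exists (opensI W W').
exists (subset_trans s1 h), (subset_trans s2 k'); split=> //.
rewrite -(rres_comp h s1) e -(rres_comp k' s2) -e'.
by rewrite (rres_comp k s1 (subset_trans s1 k)) (rres_comp h' s2 (subset_trans s1 k)).
Qed.

Canonical germ_equiv := EquivRel germ_eq germ_eq_refl germ_eq_sym germ_eq_trans.

Definition stalk := {eq_quot germ_equiv}.
HB.instance Definition _ := Choice.on stalk.

Definition germ (U : opens X) (Ux : U x) (s : O U) : stalk :=
  \pi_({eq_quot germ_equiv}) (GermRep Ux s).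

Lemma germP (a : stalk) : exists (U : opens X) (Ux : U x) s, a = germ Ux s.
Proof.
by exists _, (germ_mem (repr a)), (germ_sec (repr a)); rewrite /germ -[LHS]reprK; case: (repr a).
Qed.

Lemma germ_inj (U V : opens X) (Ux : U x) (Vx : V x) (s : O U) (t : O V) :
  germ Ux s = germ Vx t <->
  exists (W : opens X) (h : W `<=` U) (k : W `<=` V),
    W x /\ rres h s = rres k t.
Proof.
split; first by move/eqP; rewrite eqmodE => /asboolP.
by move=> H; apply/eqP; rewrite eqmodE; apply/asboolP.
Qed.

Lemma germ_res (U V : opens X) (Ux : U x) (Vx : V x) (h : V `<=` U) (s : O U) :
  germ Vx (rres h s) = germ Ux s.
Proof. by apply/germ_inj; exists V, (fun _ => id), h; split=> //; rewrite rres_id. Qed.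

Lemma opensIl (U V : opens X) : opensI U V `<=` U. Proof. by move=> y []. Qed.
Lemma opensIr (U V : opens X) : opensI U V `<=` V. Proof. by move=> y []. Qed.

Lemma germP2 (a b : stalk) :
  exists (U : opens X) (Ux : U x) s t, a = germ Ux s /\ b = germ Ux t.
Proof.
have [U [Ux [s ->]]] := germP a; have [V [Vx [t ->]]] := germP b.
have Wx : opensI U V x by split.
exists (opensI U V), Wx, (rres (@opensIl U V) s), (rres (@opensIr U V) t).
by split; rewrite germ_res.
Qed.

Lemma germP3 (a b c : stalk) : exists (U : opens X) (Ux : U x) s t u,
  [/\ a = germ Ux s, b = germ Ux t & c = germ Ux u].
Proof.
have [U [Ux [s [t [-> ->]]]]] := germP2 a b; have [V [Vx [u ->]]] := germP c.
have Wx : opensI U V x by split.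
exists (opensI U V), Wx, (rres (@opensIl U V) s), (rres (@opensIl U V) t),
  (rres (@opensIr U V) u).
by split; rewrite germ_res.
Qed.

Definition stalk_op2 (op : forall U, O U -> O U -> O U) (a b : stalk) : stalk :=
  let ra := repr a in let rb := repr b in
  germ (conj (germ_mem ra) (germ_mem rb) : opensI _ _ x)
    (op _ (rres (@opensIl _ _) (germ_sec ra))
          (rres (@opensIr _ _) (germ_sec rb))).

Definition stalk_opp (a : stalk) : stalk :=
  germ (germ_mem (repr a)) (- germ_sec (repr a)).

Definition stalk_cst (c : forall U, O U) : stalk := @germ opensT I (c opensT).

Lemma stalk_op2E (op : forall U, O U -> O U -> O U)
    (opR : forall (U V : opens X) (h : V `<=` U) s t,
       rres h (op U s t) = op V (rres h s) (rres h t))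
    (U : opens X) (Ux : U x) (s t : O U) :
  stalk_op2 op (germ Ux s) (germ Ux t) = germ Ux (op U s t).
Proof.
rewrite /stalk_op2; set a := repr _; set b := repr _.
have : germ (germ_mem a) (germ_sec a) = germ Ux s.
  by rewrite -[RHS]reprK -/a /germ; case: (a).
have : germ (germ_mem b) (germ_sec b) = germ Ux t.
  by rewrite -[RHS]reprK -/b /germ; case: (b).
move=> /germ_inj[W [h [k [Wx e]]]] /germ_inj[W' [h' [k' [Wx' e']]]].
apply/germ_inj; exists (opensI W' W).
have l : opensI W' W `<=` opensI (germ_open a) (germ_open b).
  by move=> y [/h' ? /h ?].
have m : opensI W' W `<=` U by move=> y [/k'].
exists l, m; split=> //; rewrite !opR; congr op.
  rewrite (rres_comp _ _ (subset_trans (@opensIl W' W) h')) -(rres_comp h' (@opensIl W' W)) e'.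
  exact: rres_comp.
rewrite (rres_comp _ _ (subset_trans (@opensIr W' W) h)) -(rres_comp h (@opensIr W' W)) e.
exact: rres_comp.
Qed.

Lemma stalk_oppE (U : opens X) (Ux : U x) (s : O U) :
  stalk_opp (germ Ux s) = germ Ux (- s).
Proof.
rewrite /stalk_opp; set a := repr _.
have : germ (germ_mem a) (germ_sec a) = germ Ux s.
  by rewrite -[RHS]reprK -/a /germ; case: (a).
move=> /germ_inj[W [h [k [Wx e]]]].
by apply/germ_inj; exists W, h, k; split=> //; rewrite !rmorphN e.
Qed.

Definition stalk_add := stalk_op2 (fun U => +%R).
Definition stalk_mul := stalk_op2 (fun U => *%R).
Definition stalk_zero := stalk_cst (fun U => 0).
Definition stalk_one := stalk_cst (fun U => 1).

Lemma stalk_addE (U : opens X) (Ux : U x) (s t : O U) :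
  stalk_add (germ Ux s) (germ Ux t) = germ Ux (s + t).
Proof. by apply: stalk_op2E => *; rewrite rmorphD. Qed.
Lemma stalk_mulE (U : opens X) (Ux : U x) (s t : O U) :
  stalk_mul (germ Ux s) (germ Ux t) = germ Ux (s * t).
Proof. by apply: stalk_op2E => *; rewrite rmorphM. Qed.
Lemma stalk_zeroE (U : opens X) (Ux : U x) : stalk_zero = germ Ux 0.
Proof.
by rewrite /stalk_zero /stalk_cst -(germ_res (U := opensT) I Ux (fun _ _ => I) 0) rmorph0.
Qed.
Lemma stalk_oneE (U : opens X) (Ux : U x) : stalk_one = germ Ux 1.
Proof.
by rewrite /stalk_one /stalk_cst -(germ_res (U := opensT) I Ux (fun _ _ => I) 1) rmorph1.
Qed.

Lemma stalk_addA : associative stalk_add.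
Proof.
by move=> a b c; have [U [Ux [s [t [u [-> -> ->]]]]]] := germP3 a b c;
  rewrite !stalk_addE addrA.
Qed.
Lemma stalk_addC : commutative stalk_add.
Proof.
by move=> a b; have [U [Ux [s [t [-> ->]]]]] := germP2 a b;
  rewrite !stalk_addE addrC.
Qed.
Lemma stalk_add0 : left_id stalk_zero stalk_add.
Proof.
by move=> a; have [U [Ux [s ->]]] := germP a;
  rewrite (stalk_zeroE Ux) stalk_addE add0r.
Qed.
Lemma stalk_addN : left_inverse stalk_zero stalk_opp stalk_add.
Proof.
by move=> a; have [U [Ux [s ->]]] := germP a;
  rewrite (stalk_zeroE Ux) stalk_oppE stalk_addE addNr.
Qed.
HB.instance Definition _ :=
  GRing.isZmodule.Build stalk stalk_addA stalk_addC stalk_add0 stalk_addN.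

Lemma stalk_mulA : associative stalk_mul.
Proof.
by move=> a b c; have [U [Ux [s [t [u [-> -> ->]]]]]] := germP3 a b c;
  rewrite !stalk_mulE mulrA.
Qed.
Lemma stalk_mulC : commutative stalk_mul.
Proof.
by move=> a b; have [U [Ux [s [t [-> ->]]]]] := germP2 a b;
  rewrite !stalk_mulE mulrC.
Qed.
Lemma stalk_mul1 : left_id stalk_one stalk_mul.
Proof.
by move=> a; have [U [Ux [s ->]]] := germP a;
  rewrite (stalk_oneE Ux) stalk_mulE mul1r.
Qed.
Lemma stalk_mulDl : left_distributive stalk_mul stalk_add.
Proof.
by move=> a b c; have [U [Ux [s [t [u [-> -> ->]]]]]] := germP3 a b c;
  rewrite !(stalk_addE, stalk_mulE) mulrDl.
Qed.
HB.instance Definition _ := GRing.Zmodule_isComPzRing.Build stalk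
  stalk_mulA stalk_mulC stalk_mul1 stalk_mulDl.

Lemma germ_is_zmod_morphism (U : opens X) (Ux : U x) :
  zmod_morphism (germ Ux).
Proof.
by move=> s t; apply/esym; rewrite -[LHS]/(stalk_add _ (stalk_opp _))
  stalk_oppE stalk_addE.
Qed.
Lemma germ_is_monoid_morphism (U : opens X) (Ux : U x) :
  monoid_morphism (germ Ux).
Proof.
split=> [|s t]; first by rewrite -[RHS]/stalk_one (stalk_oneE Ux).
by rewrite -[RHS]/(stalk_mul _ _) stalk_mulE.
Qed.
HB.instance Definition _ (U : opens X) (Ux : U x) :=
  GRing.isZmodMorphism.Build (O U) stalk (germ Ux) (germ_is_zmod_morphism Ux).
HB.instance Definition _ (U : opens X) (Ux : U x) :=
  GRing.isMonoidMorphism.Build (O U) stalk (germ Ux) (germ_is_monoid_morphism Ux).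

End Stalk.

Section Affine.
Variables (X : topologicalType) (O : ringSheaf X).

Definition nonvanishing (U : opens X) (f : O U) : set X :=
  [set x | exists Ux : U x, invertible (germ Ux f)].

Lemma open_nonvanishing (U : opens X) (f : O U) : open (nonvanishing f).
Proof.
rewrite openE => x [Ux [b]].
have [V [Vx [t ->]]] := germP b.
have Wx : opensI U V x by split.
rewrite -(germ_res Ux Wx (@opensIl _ U V)) -(germ_res Vx Wx (@opensIr _ U V)).
rewrite -rmorphM -(rmorph1 (germ Wx)) => /germ_inj[W [h [k [W'x]]]].
rewrite rmorphM rmorph1 => e.
rewrite /interior nbhsE; exists W; first by split=> //; exact: open_oset.
move=> y Wy; have Uy : U y by have [] := h _ Wy.
exists Uy; exists (germ Wy (rres h (rres (@opensIr _ U V) t))).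
rewrite -(germ_res Uy Wy (subset_trans h (@opensIl _ U V))) -rmorphM.
by rewrite -(rres_comp (@opensIl _ U V) h) e rmorph1.
Qed.

Definition basic_open (U : opens X) (f : O U) : opens X :=
  Opens (open_nonvanishing f).

Lemma basic_open_sub (U : opens X) (f : O U) : basic_open f `<=` U.
Proof. by move=> x []. Qed.

(* U, with the restriction of O, is an affine scheme: the canonical morphism  *)
(* U -> Spec (O U), x |-> {f | f vanishes at x}, is bijective, a              *)
(* homeomorphism, and identifies O (D(f)) with the localization (O U)_f.      *)
Definition affine (U : opens X) :=
  [/\ forall P : set (O U), prime_ideal P ->
        exists! x, U x /\ [set f | ~ basic_open f x] = P,
      forall (V : opens X) x, V `<=` U -> V x ->
        exists f : O U, basic_open f x /\ basic_open f `<=` V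
    & forall f : O U, is_localization f (rres (@basic_open_sub U f))].

End Affine.

Record scheme := Scheme {
  sch_space :> topologicalType;
  str_sheaf : ringSheaf sch_space;
  sch_local : forall x, local_ring (stalk str_sheaf x);
  sch_affine : forall x, exists U : opens sch_space, U x /\ affine str_sheaf U }.

Local Notation "''O_' X" := (str_sheaf X) (at level 8, X at level 2).

Definition preim (X Y : topologicalType) (f : X -> Y) (cf : continuous f)
  (V : opens Y) : opens X := Opens ((continuousP f).1 cf _ (open_oset V)).

Record morphism (X Y : scheme) := Morphism {
  mor_fun :> X -> Y;
  mor_cont : continuous mor_fun;
  mor_pull : forall V : opens Y, {rmorphism 'O_Y V -> 'O_X (preim mor_cont V)};
  mor_nat : forall (U V : opens Y) (h : V `<=` U)
    (k : preim mor_cont V `<=` preim mor_cont U) s,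
    mor_pull V (rres h s) = rres k (mor_pull U s);
  mor_local : forall x (V : opens Y) (Vfx : V (mor_fun x)) s,
    invertible (germ (Vfx : preim mor_cont V x) (mor_pull V s)) ->
    invertible (germ Vfx s) }.

Arguments mor_cont {X Y} m : rename.

Section SchemeProperties.
Variable X : scheme.

Definition integral_scheme :=
  (exists x : X, True) /\
  forall U : opens X, (exists x, U x) -> integral_domain ('O_X U).

Definition noetherian_scheme :=
  compact [set: X] /\
  forall x : X, exists U : opens X,
    [/\ U x, affine 'O_X U & noetherian_ring ('O_X U)].

Definition nagata_scheme :=
  forall x : X, exists U : opens X,
    [/\ U x, affine 'O_X U & nagata_ring ('O_X U)].

Definition normal_scheme := forall x : X, normal_domain (stalk 'O_X x).

End SchemeProperties.

(* For X integral with generic point eta, so that stalk 'O_X eta is its       *)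
(* function field: nu is the relative spectrum of the integral closure of     *)
(* 'O_X in the constant sheaf of rational functions, i.e. nu is affine, and   *)
(* over an affine open U it is given by the integral closure of 'O_X U in the *)
(* function field.                                                            *)
Definition is_normalization (X Xnu : scheme) (nu : morphism Xnu X) :=
  exists eta : X, closure [set eta] = [set: X] /\
  forall (U : opens X) (Ueta : U eta), affine 'O_X U ->
    affine 'O_Xnu (preim (mor_cont nu) U) /\
    exists j : {rmorphism 'O_Xnu (preim (mor_cont nu) U) -> stalk 'O_X eta},
      [/\ injective j,
          forall a, j (mor_pull nu U a) = germ Ueta a
        & range j = [set y | integral_over (germ Ueta) y]].

Record modSheaf (X : topologicalType) (O : ringSheaf X) := ModSheaf {
  msec :> forall U : opens X, lmodType (O U);
  mres : forall U V : opens X, V `<=` U -> msec U -> msec V;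
  mres_lin : forall (U V : opens X) (h : V `<=` U) (a : O U) (s t : msec U),
    mres h (a *: s + t) = rres h a *: mres h s + mres h t;
  mres_id : forall (U : opens X) (h : U `<=` U) s, mres h s = s;
  mres_comp : forall (U V W : opens X) (h : V `<=` U) (k : W `<=` V)
    (l : W `<=` U) s, mres k (mres h s) = mres l s;
  mres_sheaf : @sheaf_axiom X msec mres }.
Arguments mres {X O m U V} h s.

Record modHom (X : topologicalType) (O : ringSheaf X) (M N : modSheaf O) :=
  ModHom {
  hom_fun :> forall U : opens X, M U -> N U;
  hom_lin : forall U : opens X, linear (@hom_fun U);
  hom_nat : forall (U V : opens X) (h : V `<=` U) s,
    hom_fun (mres h s) = mres h (hom_fun s) }.
Arguments hom_fun {X O M N} m U s.

HB.instance Definition _ (X : topologicalType) (O : ringSheaf X)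
    (M N : modSheaf O) (f : modHom M N) (U : opens X) :=
  GRing.isLinear.Build (O U) (M U) (N U) _ (hom_fun f U) (hom_lin f (U := U)).

Section ModuleConstructions.
Variables (X : topologicalType) (O : ringSheaf X).

Lemma mresD (M : modSheaf O) (U V : opens X) (h : V `<=` U) (s t : M U) :
  mres h (s + t) = mres h s + mres h t.
Proof. by rewrite -[s]scale1r mres_lin rmorph1 !scale1r. Qed.

Lemma mres0 (M : modSheaf O) (U V : opens X) (h : V `<=` U) :
  mres h (0 : M U) = 0.
Proof. by apply: (addIr (mres h 0)); rewrite -mresD !add0r. Qed.

Lemma mresN (M : modSheaf O) (U V : opens X) (h : V `<=` U) (s : M U) :
  mres h (- s) = - mres h s.
Proof. by apply: (addIr (mres h s)); rewrite -mresD !addNr mres0. Qed.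

Lemma mresZ (M : modSheaf O) (U V : opens X) (h : V `<=` U) a (s : M U) :
  mres h (a *: s) = rres h a *: mres h s.
Proof. by rewrite -[a *: s]addr0 mres_lin mres0 addr0. Qed.

Lemma homD (M N : modSheaf O) (f : modHom M N) U s t :
  f U (s + t) = f U s + f U t.
Proof. exact: (linearD (hom_fun f U)). Qed.

Lemma homN (M N : modSheaf O) (f : modHom M N) U s : f U (- s) = - f U s.
Proof. exact: (linearN (hom_fun f U)). Qed.

Lemma hom0 (M N : modSheaf O) (f : modHom M N) U : f U 0 = 0.
Proof. exact: (linear0 (hom_fun f U)). Qed.

Program Definition zero_mod : modSheaf O := @ModSheaf X O
  (fun U => 'rV[O U]_0) (fun U V h s => 0) _ _ _ _.
Next Obligation. by move=> U V h a s t /=; rewrite scaler0 addr0. Qed.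
Next Obligation. by move=> U h s /=; rewrite [s]thinmx0. Qed.
Next Obligation. by []. Qed.
Next Obligation.
by move=> U C s CU _; exists 0; split=> [V CV|t _] /=; rewrite ?[s V]thinmx0 // [t]thinmx0.
Qed.

Program Definition struct_mod : modSheaf O := @ModSheaf X O
  (fun U => (O U)^o) (fun U V h s => rres h s) _ _ _ _.
Next Obligation. by move=> U V h a s t /=; rewrite rmorphD rmorphM. Qed.
Next Obligation. exact: rres_id. Qed.
Next Obligation. exact: rres_comp. Qed.
Next Obligation. exact: (@rres_sheaf X O). Qed.

Program Definition sum_mod (M N : modSheaf O) : modSheaf O := @ModSheaf X O
  (fun U => (M U * N U)%type) (fun U V h s => (mres h s.1, mres h s.2)) _ _ _ _.
Next Obligation. by move=> M N U V h a s t /=; rewrite !mres_lin. Qed.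
Next Obligation. by move=> M N U h [s t] /=; rewrite !mres_id. Qed.
Next Obligation. by move=> M N U V W h k l [s t] /=; rewrite !(mres_comp _ _ l). Qed.
Next Obligation.
move=> M N U C s CU cpt.
have [V V' W h k CV CV'|t1 [e1 u1]] :=
    @mres_sheaf _ _ M U C (fun V => (s V).1) CU.
  by have [] := cpt V V' W h k CV CV'.
have [V V' W h k CV CV'|t2 [e2 u2]] :=
    @mres_sheaf _ _ N U C (fun V => (s V).2) CU.
  by have [] := cpt V V' W h k CV CV'.
exists (t1, t2); split=> [V CV|[t1' t2'] e] /=.
  by rewrite e1 e2; case: (s V).
by congr pair; [apply: u1 | apply: u2] => V CV; rewrite -e.
Qed.

Program Definition hom_id (M : modSheaf O) : modHom M M :=
  @ModHom X O M M (fun U s => s) _ _.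
Next Obligation. by []. Qed.
Next Obligation. by []. Qed.

Program Definition hom_comp (M N P : modSheaf O) (g : modHom N P)
  (f : modHom M N) : modHom M P := @ModHom X O M P (fun U s => g U (f U s)) _ _.
Next Obligation. by move=> M N P g f U a s t; rewrite !linearP. Qed.
Next Obligation. by move=> M N P g f U V h s /=; rewrite !hom_nat. Qed.

Program Definition hom_zero (M N : modSheaf O) : modHom M N :=
  @ModHom X O M N (fun U s => 0) _ _.
Next Obligation. by move=> M N U a s t; rewrite scaler0 addr0. Qed.
Next Obligation. by move=> M N U V h s /=; rewrite mres0. Qed.

Program Definition hom_opp (M N : modSheaf O) (f : modHom M N) : modHom M N :=
  @ModHom X O M N (fun U s => - f U s) _ _.
Next Obligation. by move=> M N f U a s t; rewrite linearP opprD scalerN. Qed.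
Next Obligation. by move=> M N f U V h s /=; rewrite hom_nat mresN. Qed.

Definition injective_mod (I : modSheaf O) :=
  forall (A B : modSheaf O) (i : modHom A B) (g : modHom A I),
    (forall U, injective (i U)) ->
    exists h : modHom B I, forall U s, h U (i U s) = g U s.

(* the sections s_1, ..., s_n over U generate M restricted to U *)
Definition generates (M : modSheaf O) (U : opens X) n (s : 'I_n -> M U) :=
  forall (V : opens X) (h : V `<=` U) (t : M V),
    locally_on (fun W (k : W `<=` V) =>
      exists c : 'I_n -> O W,
        mres k t = \sum_(i < n) c i *: mres k (mres h (s i))).

Definition finite_type (M : modSheaf O) :=
  forall x : X, exists (U : opens X) n (s : 'I_n -> M U),
    U x /\ generates s.

(* the kernel of O^n -> M over U defined by s_1, ..., s_n is of finite type   *)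
Definition relations_finite_type (M : modSheaf O) (U : opens X) n
    (s : 'I_n -> M U) :=
  locally_on (fun V (h : V `<=` U) =>
    exists m (r : 'I_m -> 'I_n -> O V),
      (forall j, \sum_(i < n) r j i *: mres h (s i) = 0) /\
      forall (W : opens X) (k : W `<=` V) (t : 'I_n -> O W),
        \sum_(i < n) t i *: mres k (mres h (s i)) = 0 ->
        locally_on (fun W' (l : W' `<=` W) =>
          exists c : 'I_m -> O W', forall i,
            rres l (t i) = \sum_(j < m) c j * rres l (rres k (r j i)))).

(* Over an arbitrary ringed space: M is of finite type, and the kernel of     *)
(* every O^n -> M over an open U is of finite type.                           *)
Definition coherent (M : modSheaf O) :=
  finite_type M /\
  forall (U : opens X) n (s : 'I_n -> M U), relations_finite_type s.

End ModuleConstructions.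

Section Complexes.
Variables (X : topologicalType) (O : ringSheaf X).

Record complex := Complex {
  cx_obj :> int -> modSheaf O;
  cx_d : forall i : int, modHom (cx_obj i) (cx_obj (i + 1));
  cx_dd : forall (i : int) U s, cx_d (i + 1) U (cx_d i U s) = 0 }.

Record chainMap (K L : complex) := ChainMap {
  cm_fun :> forall i : int, modHom (K i) (L i);
  cm_d : forall (i : int) U s,
    cm_fun (i + 1) U (cx_d K i U s) = cx_d L i U (cm_fun i U s) }.

Program Definition cm_id (K : complex) : chainMap K K :=
  @ChainMap K K (fun i => hom_id (K i)) _.
Next Obligation. by []. Qed.

Program Definition cm_comp (K L P : complex) (g : chainMap L P)
    (f : chainMap K L) : chainMap K P :=
  @ChainMap K P (fun i => hom_comp (g i) (f i)) _.
Next Obligation. by move=> K L P g f i U s /=; rewrite !cm_d. Qed.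

Definition homotopic (K L : complex) (f g : chainMap K L) :=
  exists h : forall i : int, modHom (K (i + 1)) (L i),
  forall (i : int) U (s : K (i + 1) U),
    f (i + 1) U s - g (i + 1) U s =
    cx_d L i U (h i U s) + h (i + 1) U (cx_d K (i + 1) U s).

Definition boundary (K : complex) (i : int) (U : opens X)
    (s : K (i + 1) U) :=
  locally_on (fun V (h : V `<=` U) =>
    exists t : K i V, cx_d K i V t = mres h s).

(* f induces an isomorphism on the sheafification of U |-> H^(i+1)(K(U)),     *)
(* i.e. the map of presheaves is locally injective and locally surjective;    *)
(* i + 1 ranges over all of int.                                              *)
Definition quasi_iso (K L : complex) (f : chainMap K L) :=
  forall i : int,
  (forall U (s : K (i + 1) U), cx_d K (i + 1) U s = 0 ->
     boundary (f (i + 1) U s) -> boundary s) /\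
  (forall U (t : L (i + 1) U), cx_d L (i + 1) U t = 0 ->
     locally_on (fun V (h : V `<=` U) =>
       exists s : K (i + 1) V, cx_d K (i + 1) V s = 0 /\
         boundary (mres h t - f (i + 1) V s))).

Program Definition zero_cx : complex :=
  @Complex (fun=> zero_mod O) (fun=> hom_zero _ _) _.
Next Obligation. by []. Qed.

Program Definition single (M : modSheaf O) : complex :=
  @Complex (fun i => if i == 0 then M else zero_mod O) (fun i => hom_zero _ _) _.
Next Obligation. by []. Qed.

Program Definition shift (K : complex) : complex :=
  @Complex (fun i => K (i + 1)) (fun i => hom_opp (cx_d K (i + 1))) _.
Next Obligation. by move=> K i U s /=; rewrite homN cx_dd !oppr0. Qed.

Program Definition sum_d (K L : complex) (i : int) :
    modHom (sum_mod (K i) (L i)) (sum_mod (K (i + 1)) (L (i + 1))) :=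
  @ModHom X O _ _ (fun U s => (cx_d K i U s.1, cx_d L i U s.2)) _ _.
Next Obligation. by move=> K L i U a s t /=; rewrite !linearP. Qed.
Next Obligation. by move=> K L i U V h s /=; rewrite !hom_nat. Qed.

Program Definition sum_cx (K L : complex) : complex :=
  @Complex (fun i => sum_mod (K i) (L i)) (sum_d K L) _.
Next Obligation. by move=> K L i U s /=; rewrite !cx_dd. Qed.

Program Definition cone_d (K L : complex) (f : chainMap K L) (i : int) :
    modHom (sum_mod (K (i + 1)) (L i)) (sum_mod (K (i + 1 + 1)) (L (i + 1))) :=
  @ModHom X O _ _
    (fun U s => (- cx_d K (i + 1) U s.1, f (i + 1) U s.1 + cx_d L i U s.2)) _ _.
Next Obligation.
move=> K L f i U a s t /=; rewrite !hom_lin.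
by congr pair; rewrite /= ?opprD ?scalerN // scalerDr addrACA.
Qed.
Next Obligation.
move=> K L f i U V h s /=; rewrite !hom_nat mresD; congr pair.
by rewrite mresN.
Qed.

Program Definition cone (K L : complex) (f : chainMap K L) : complex :=
  @Complex (fun i => sum_mod (K (i + 1)) (L i)) (cone_d f) _.
Next Obligation.
move=> K L f i U s /=; congr pair; first by rewrite homN cx_dd !oppr0.
by rewrite homD cx_dd addr0 homN cm_d addNr.
Qed.

(* Morphisms E -> F in the derived category are represented by roofs          *)
(* E <- Z -> F whose left leg is a quasi-isomorphism.                         *)
Record roof (E F : complex) := Roof {
  apex : complex;
  left_leg : chainMap apex E;
  left_qis : quasi_iso left_leg;
  right_leg : chainMap apex F }.

Definition roof_eq (E F : complex) (a b : roof E F) :=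
  exists (Z : complex) (u : chainMap Z (apex a)) (v : chainMap Z (apex b)),
    [/\ quasi_iso (cm_comp (left_leg a) u),
        homotopic (cm_comp (left_leg a) u) (cm_comp (left_leg b) v)
      & homotopic (cm_comp (right_leg a) u) (cm_comp (right_leg b) v)].

Lemma quasi_iso_id (K : complex) : quasi_iso (cm_id K).
Proof.
move=> i; split=> // U t dt x Ux.
exists U, (fun _ => id); split=> //; exists t; split=> //= y Uy.
exists U, (fun _ => id); split=> //; exists 0.
by rewrite hom0 !mres_id subrr.
Qed.

Definition roof_id (E : complex) : roof E E :=
  Roof (@quasi_iso_id E) (cm_id E).

(* c represents the composite of a followed by b *)
Definition roof_comp (E F G : complex) (a : roof E F) (b : roof F G)
    (c : roof E G) :=
  exists (V : complex) (r : chainMap V (apex a)) (h : chainMap V (apex b))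
    (q : quasi_iso (cm_comp (left_leg a) r)),
    homotopic (cm_comp (left_leg b) h) (cm_comp (right_leg a) r) /\
    roof_eq c (Roof q (cm_comp (right_leg b) h)).

Definition derived_iso (E F : complex) :=
  exists (a : roof E F) (b : roof F E),
    roof_comp a b (roof_id E) /\ roof_comp b a (roof_id F).

(* C is a cone of the morphism A -> B of the derived category represented by  *)
(* the roof a                                                                 *)
Definition is_cone (A B : complex) (a : roof A B) (C : complex) :=
  derived_iso C (cone (right_leg a)).

(* H is the cohomology sheaf in degree i + 1: the cokernel of K^i -> Z, where *)
(* Z is the kernel of K^(i+1) -> K^(i+2)                                      *)
Definition is_cohomology (K : complex) (i : int) (H : modSheaf O) :=
  exists (Z : modSheaf O) (iota : modHom Z (K (i + 1))) (pi : modHom Z H),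
    [/\ forall U, injective (iota U),
        forall U, range (iota U) = [set s | cx_d K (i + 1) U s = 0],
        forall U (t : H U), locally_on (fun V (h : V `<=` U) =>
          exists z : Z V, pi V z = mres h t)
      & forall U (z : Z U), pi U z = 0 <-> boundary (iota U z)].

Definition Dbcoh (K : complex) :=
  (exists N : int, forall (i : int) U (s : K (i + 1) U),
     N <= `|i| -> cx_d K (i + 1) U s = 0 -> boundary s) /\
  (forall i : int, exists H, is_cohomology K i H /\ coherent H).

(* T is a strictly full triangulated subcategory of the derived category, so  *)
(* membership in T needs to be required only of generators and of summands.   *)
(* Closure under the inverse shift is expressed by add_unshift.               *)
Inductive add (T S : complex -> Prop) : complex -> Prop :=
| add_in K : T K -> S K -> add T S K
| add_iso K L : derived_iso K L -> add T S K -> add T S L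
| add_zero : add T S zero_cx
| add_sum K L : add T S K -> add T S L -> add T S (sum_cx K L)
| add_shift K : add T S K -> add T S (shift K)
| add_unshift K : add T S (shift K) -> add T S K
| add_summand K L : T K -> T L -> add T S (sum_cx K L) -> add T S K.

Fixpoint generated (T : complex -> Prop) (G : complex) (n : nat) :
    complex -> Prop :=
  match n with
  | 0 => add T (fun K => K = zero_cx)
  | 1 => add T (fun K => K = G)
  | m.+1 => add T (fun C => exists A B (a : roof A B),
              [/\ generated T G m A, add T (fun K => K = G) B & is_cone a C])
  end.

(* None stands for infinity *)
Definition level (T : complex -> Prop) (G E : complex) : option nat :=
  if pselect (exists n, `[< generated T G n E >]) is left ex
  then Some (ex_minn ex) else None.

Definition level_le (l : option nat) (n : nat) : bool :=
  if l is Some m then (m <= n)%N else false.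

End Complexes.

(* restriction of scalars along f *)
Definition rscal (R S : comPzRingType) (f : {rmorphism R -> S})
  (M : lmodType S) : Type := M.

Section RestrictScalars.
Variables (R S : comPzRingType) (f : {rmorphism R -> S}) (M : lmodType S).

HB.instance Definition _ := GRing.Zmodule.on (rscal f M).

Definition rscal_scale (a : R) (v : rscal f M) : rscal f M :=
  f a *: (v : M).

Lemma rscal_scaleA a b v :
  rscal_scale a (rscal_scale b v) = rscal_scale (a * b) v.
Proof. by rewrite /rscal_scale scalerA rmorphM. Qed.
Lemma rscal_scale1 : left_id 1 rscal_scale.
Proof. by move=> v; rewrite /rscal_scale rmorph1 scale1r. Qed.
Lemma rscal_scaleDr : right_distributive rscal_scale +%R.
Proof. by move=> a v w; rewrite /rscal_scale scalerDr. Qed.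
Lemma rscal_scaleDl v : {morph rscal_scale^~ v : a b / a + b}.
Proof. by move=> a b; rewrite /rscal_scale rmorphD scalerDl. Qed.
HB.instance Definition _ := GRing.Zmodule_isLmodule.Build R (rscal f M)
  rscal_scaleA rscal_scale1 rscal_scaleDr rscal_scaleDl.

End RestrictScalars.

Section DirectImage.
Variables (X Y : scheme) (f : morphism X Y).

Let pre (V : opens Y) : opens X := preim (mor_cont f) V.

Lemma preimS (U V : opens Y) : V `<=` U -> pre V `<=` pre U.
Proof. by move=> h x; apply: h. Qed.

Section Module.
Variable M : modSheaf 'O_X.

Definition push_sec (V : opens Y) : lmodType ('O_Y V) :=
  rscal (mor_pull f V) (M (pre V)).

Definition push_res (U V : opens Y) (h : V `<=` U) (s : push_sec U) :
  push_sec V := mres (preimS h) (s : M (pre U)).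

Lemma push_res_lin (U V : opens Y) (h : V `<=` U) (a : 'O_Y U)
    (s t : push_sec U) :
  push_res h (a *: s + t) = rres h a *: push_res h s + push_res h t.
Proof.
by rewrite /push_res mres_lin -(mor_nat h (preimS h)).
Qed.

Lemma push_sheaf : @sheaf_axiom Y push_sec push_res.
Proof.
move=> U C s CU cpt.
pose C' : set (opens X) := [set pre V | V in C].
pose P (W : opens X) := exists V, C V /\ W `<=` pre V.
pose s' (W : opens X) : M W :=
  if pselect (P W) is left ex
  then mres (proj2 (projT2 (cid ex))) (s (projT1 (cid ex)) : M (pre _)) else 0.
have s'E (V : opens Y) (W : opens X) (h : W `<=` pre V) : C V ->
    s' W = mres h (s V : M (pre V)).
  move=> CV; rewrite /s'; case: pselect => [ex|]; last by case; exists V.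
  case: (cid ex) => V' [CV' h'] /=.
  have e := cpt V' V (opensI V' V) (@opensIl _ _ _) (@opensIr _ _ _) CV' CV.
  have k : W `<=` pre (opensI V' V) by move=> y Wy; split; [exact: h'|exact: h].
  move: (congr1 (fun z : push_sec (opensI V' V) => mres k (z : M (pre _))) e).
  rewrite /push_res (mres_comp _ _ h') (mres_comp _ _ h) => <-.
  by congr mres; exact: Prop_irrelevance.
have C'U : covers C' (pre U).
  split=> [_ [V CV <-] x|x Ux]; first exact: CU.1.
  by have [V CV Vx] := CU.2 _ Ux; exists (pre V) => //; exists V.
have [|t [te tu]] := @mres_sheaf _ _ M (pre U) C' s' C'U.
  move=> A B W h h' [V CV eA] [V' CV' eB]; subst A B.
  rewrite (s'E V _ (fun _ => id)) // (s'E V' _ (fun _ => id)) // !mres_id.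
  by rewrite -(s'E V W h CV) -(s'E V' W h' CV').
exists t; split=> [V CV|t' e].
  have CV' : C' (pre V) by exists V.
  have := te _ CV'; rewrite (s'E V _ (fun _ => id)) // mres_id => <-.
  by rewrite /push_res; congr mres; exact: Prop_irrelevance.
apply: tu => A [V CV eA]; subst A; rewrite (s'E V _ (fun _ => id)) // mres_id -e.
by rewrite /push_res; congr mres; exact: Prop_irrelevance.
Qed.

Definition push_mod : modSheaf 'O_Y :=
  ModSheaf push_res_lin
    (fun U h s => mres_id (preimS h) (s : M _))
    (fun U V W h k l s => mres_comp (preimS h) (preimS k) (preimS l) (s : M _))
    push_sheaf.

End Module.

Program Definition push_hom (M N : modSheaf 'O_X) (g : modHom M N) :
    modHom (push_mod M) (push_mod N) :=
  @ModHom Y 'O_Y (push_mod M) (push_mod N) (fun V s => g (pre V) s) _ _.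
Next Obligation.
by move=> M N g V a s t; exact: (linearP (hom_fun g (pre V)) (mor_pull f V a)).
Qed.
Next Obligation. by move=> M N g U V h s; exact: (hom_nat g (preimS h)). Qed.

Program Definition push_cx (K : complex 'O_X) : complex 'O_Y :=
  @Complex Y 'O_Y (fun i => push_mod (K i)) (fun i => push_hom (cx_d K i)) _.
Next Obligation. by move=> K i V s; exact: cx_dd. Qed.

(* G represents the total right derived direct image of K (for K with         *)
(* cohomology bounded below), computed by an injective resolution I of K.     *)
Definition is_derived_push (K : complex 'O_X) (G : complex 'O_Y) :=
  exists (I : complex 'O_X) (eps : chainMap K I),
    [/\ quasi_iso eps,
        forall i, injective_mod (I i),
        exists n : int, forall (i : int) U (s : I i U), i < n -> s = 0
      & derived_iso (push_cx I) G].

End DirectImage.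

(* Main.v *)
From HB Require Import structures.
Require Import Defs.
From mathcomp Require Import all_boot all_order all_algebra.
From mathcomp Require Import boolp classical_sets topology.
From mathcomp Require Import ring.

(* Write y = a / b with a, b sections of O_X over an affine open U and y       *)
(* integral over O_X(U).                                                      *)
(* If the level is at most 1: y is a section of O_(X^nu) over nu^-1(U), so    *)
(* a = b y acts on any complex of O_(X^nu)-modules with image in that of b,   *)
(* and every cohomology sheaf H of R nu_* O over U satisfies a H <= b H.      *)
(* This property passes to sums, shifts and quotients of cohomology, hence to *)
(* all of add(R nu_* O); for O_X in degree 0 it says that b divides a in the  *)
(* stalks. Nothing has to be known about the higher direct images.            *)
(* Conversely, if X is normal then nu is an isomorphism, so nu_* preserves    *)
(* quasi-isomorphisms and R nu_* O is O_X, which lies in D^b_coh because X is *)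
(* Noetherian.                                                                *)

(** How the lemmas carry this. An isomorphism of the derived category, given by roofs, yields two
    quasi-isomorphisms out of one complex ([derived_iso_roof]), so an invariant of isomorphism
    classes only has to be transported along quasi-isomorphisms.

    The invariant for the first implication is [coho_div a b], meaning a H <= b H for all cohomology
    sheaves H over U. It holds for every direct image as soon as a = b y on the preimage of U
    ([coho_div_push]), spreads to all of [add] ([coho_div_add]), and on O_X says that b divides a in
    each stalk over U ([coho_div_struct_mod]). In [normal_of_coho_div] an element of a fraction
    field integral over the stalk at x is multiplied by a unit of the stalk, so that it becomes a
    fraction of sections over an affine U, integral over O_X(U). Such a fraction is a section
    upstairs; divisibility then puts it in the stalk.

    For the second implication, normality makes nu an isomorphism over affine opens
    ([normal_iso_affine]). Then O_X -> nu_* O -> nu_* I is a quasi-isomorphism for the injective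
    resolution I ([quasi_iso_pull], [quasi_iso_push]), and [coherent_struct_mod] with
    [Dbcoh_derived_iso] shows that G itself lies in D^b_coh, as membership in [add] demands. *)

Set Implicit Arguments.
Unset Strict Implicit.
Unset Printing Implicit Defensive.

Import GRing.Theory.
Local Open Scope classical_set_scope.
Local Open Scope ring_scope.

(** * Noetherian rings and localizations *)

Section Algebra.

Lemma invertibleX (A : comPzRingType) (a : A) n :
  invertible a -> invertible (a ^+ n).
Proof. by move=> [b ab]; exists (b ^+ n); rewrite -exprMn ab expr1n. Qed.

Lemma invertible_morph (A B : comPzRingType) (phi : {rmorphism A -> B}) a :
  invertible a -> invertible (phi a).
Proof. by move=> [b ab]; exists (phi b); rewrite -rmorphM ab rmorph1. Qed.

Lemma invertibleM (A : comPzRingType) (a b : A) :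
  invertible (a * b) <-> invertible a /\ invertible b.
Proof.
split=> [[c abc]|[[c ac] [d bd]]].
  by split; [exists (b * c)|exists (a * c)]; rewrite -abc mulrA // (mulrC b).
by exists (c * d); rewrite mulrACA ac bd mulr1.
Qed.

Lemma invertible_mulIf (A : comPzRingType) (a b : A) :
  invertible a -> a * b = 0 -> b = 0.
Proof. by move=> [c ac] ab; rewrite -[b]mul1r -ac mulrAC ab mul0r. Qed.

Lemma localization_common (A B : comPzRingType) (f : A)
    (phi : {rmorphism A -> B}) n (b : 'I_n -> B) :
  is_localization f phi ->
  exists N (a : 'I_n -> A), forall i, phi f ^+ N * b i = phi (a i).
Proof.
move=> [_ frac _]; have /choice[e he] : forall i, exists e : nat * A,
    phi f ^+ e.1 * b i = phi e.2.
  by move=> i; have [m [a E]] := frac (b i); exists (m, a).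
exists (\max_i (e i).1)%N, (fun i => f ^+ (\max_i (e i).1 - (e i).1) * (e i).2).
move=> i; rewrite rmorphM -he rmorphXn mulrA -exprD subnK //.
exact: leq_bigmax.
Qed.

(** Induction on n: the first coordinates of elements of S form an ideal, and the elements with
    first coordinate 0 form a submodule of A^(n-1), embedded by [ext]. Lifts of generators of the
    former together with generators of the latter generate S. *)
Lemma noetherian_submodule (A : comPzRingType) n (S : set ('I_n -> A)) :
  noetherian_ring A -> S (fun=> 0) ->
  (forall a s t, S s -> S t -> S (fun i => a * s i + t i)) ->
  exists m (r : 'I_m -> 'I_n -> A), (forall j, S (r j)) /\
    forall t, S t -> exists c : 'I_m -> A,
      forall i, t i = \sum_(j < m) c j * r j i.
Proof.
move=> nA; elim: n S => [|n IH] S S0 SL.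
  exists 0%N, (fun=> fun=> 0); split=> [[]//|t _].
  by exists (fun=> 0) => -[].
have Ssum m (c : 'I_m -> A) (r : 'I_m -> 'I_n.+1 -> A) : (forall j, S (r j)) ->
    S (fun i => \sum_(j < m) c j * r j i).
  elim: m c r => [|m IHm] c r Sr.
    by under eq_fun do rewrite big_ord0.
  under eq_fun do rewrite big_ord_recl.
  by apply: SL => //; apply: IHm => j.
have [|k [g Ig]] := nA [set a | exists2 s, S s & s ord0 = a].
  split; first by exists (fun=> 0).
    move=> _ _ [s Ss <-] [t St <-].
    by exists (fun i => 1 * s i + t i); [exact: SL|rewrite mul1r].
  move=> a _ [s Ss <-]; exists (fun i => a * s i + 0); last by rewrite addr0.
  exact: (SL a s (fun=> 0)).
have /choice[r0 r0P] : forall j : 'I_k, exists s, S s /\ s ord0 = g j.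
  move=> j; have : [set a | exists2 s, S s & s ord0 = a] (g j).
    rewrite Ig; exists (fun j' => (j' == j)%:R); rewrite (bigD1 j) //= eqxx mul1r.
    by rewrite big1 ?addr0 // => j' /negbTE ->; rewrite mul0r.
  by case=> s Ss e; exists s.
pose ext (u : 'I_n -> A) (i : 'I_n.+1) := if unlift ord0 i is Some j then u j else 0.
have [||m [r1 [Sr1 gen1]]] := IH [set u | S (ext u)].
- rewrite /=; suff -> : ext (fun=> 0) = fun=> 0 by [].
  by apply/funext => i; rewrite /ext; case: unliftP.
- move=> a s t /= Ss St; suff -> : ext (fun i => a * s i + t i)
    = fun i => a * ext s i + ext t i by exact: SL.
  by apply/funext => i; rewrite /ext; case: unliftP => // _; rewrite mulr0 addr0.
exists (k + m)%N, (fun j =>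
  match fintype.split j with inl j0 => r0 j0 | inr j1 => ext (r1 j1) end).
split=> [j|t St]; first by case: fintype.split => j'; [exact: (r0P j').1|exact: Sr1].
have : [set a | exists2 s, S s & s ord0 = a] (t ord0) by exists t.
rewrite Ig => -[c tc].
pose t0 i := \sum_(j < k) c j * r0 j i.
have St0 : S t0 by apply: Ssum => j; exact: (r0P j).1.
have t00 : t0 ord0 = t ord0.
  by rewrite tc; apply: eq_bigr => j _; rewrite (r0P j).2.
have [|c1 tc1] := gen1 (fun i => t (lift ord0 i) - t0 (lift ord0 i)).
  rewrite /=; suff -> : ext (fun i => t (lift ord0 i) - t0 (lift ord0 i)) =
    fun i => -1 * t0 i + t i by exact: SL.
  apply/funext => i; rewrite /ext mulN1r addrC; case: unliftP => [j ->//|->].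
  by rewrite t00 subrr.
exists (fun j => match fintype.split j with inl j0 => c j0 | inr j1 => c1 j1 end) => i.
rewrite big_split_ord /=.
under eq_bigr => j _ do rewrite (unsplitK (inl j)).
under [X in _ + X]eq_bigr => j _ do rewrite (unsplitK (inr j)).
case: (unliftP ord0 i) => [j ->|->].
  rewrite -[t _](subrK (t0 (lift ord0 j))) addrC tc1; congr (_ + _).
  by apply: eq_bigr => l _; rewrite /ext liftK.
rewrite -t00 [X in _ = _ + X]big1 ?addr0 // => l _.
by rewrite /ext unlift_none mulr0.
Qed.

End Algebra.

(** * Gluing and sections over affine opens *)

Section Sections.
Variables (X : topologicalType) (O : ringSheaf X).

Lemma mres_ext (M : modSheaf O) (U : opens X) (s t : M U) :
  locally_on (fun V (h : V `<=` U) => mres h s = mres h t) -> s = t.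
Proof.
move=> st; pose C := [set V : opens X | exists h : V `<=` U, mres h s = mres h t].
have CU : covers C U.
  split=> [V []//|x Ux]; have [V [h [Vx e]]] := st x Ux.
  by exists V => //; exists h.
pose s' V : M V := if pselect (V `<=` U) is left h then mres h s else 0.
have s'E (V : opens X) (h : V `<=` U) : s' V = mres h s.
  by rewrite /s'; case: pselect => // k; congr mres; exact: Prop_irrelevance.
have [|w [_ u]] := @mres_sheaf _ _ M U C s' CU.
  move=> V V' W h h' CV CV'; rewrite (s'E V (CU.1 V CV)) (s'E V' (CU.1 V' CV')).
  rewrite (mres_comp _ h (subset_trans h (CU.1 V CV))).
  by rewrite (mres_comp _ h' (subset_trans h (CU.1 V CV))).
rewrite -(u s) => [|V CV]; last by rewrite -s'E.
apply: u => V CV; rewrite (s'E _ (CU.1 V CV)).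
have [h e] := CV; by rewrite (Prop_irrelevance (CU.1 V CV) h).
Qed.

(** Gluing for local sections given by a functional relation R stable under restriction. The sheaf
    axiom wants a total family, so values are chosen from R on the cover and set to 0 elsewhere. *)
Lemma mres_glue (M : modSheaf O) (U : opens X)
    (R : forall V : opens X, V `<=` U -> M V -> Prop) :
  (forall (V : opens X) h m m', R V h m -> R V h m' -> m = m') ->
  (forall (V : opens X) h (W : opens X) (k : W `<=` V) (l : W `<=` U) m,
     R V h m -> R W l (mres k m)) ->
  locally_on (fun V (h : V `<=` U) => exists m, R V h m) ->
  exists m : M U, forall (V : opens X) h m', R V h m' -> mres h m = m'.
Proof.
move=> Runiq Rres Rloc.
pose C := [set V : opens X | exists (h : V `<=` U) m, R V h m].
have CU : covers C U.
  split=> [V []//|x Ux]; have [V [h [Vx e]]] := Rloc x Ux.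
  by exists V => //; exists h.
pose s V : M V := if pselect (C V) is left c then projT1 (cid (projT2 (cid c))) else 0.
have sP (V : opens X) (h : V `<=` U) : C V -> R V h (s V).
  move=> CV; rewrite /s; case: pselect => // c.
  case: cid => k kP /=; case: cid => m /=.
  by rewrite (Prop_irrelevance k h).
have [|w [wP _]] := @mres_sheaf _ _ M U C s CU.
  move=> V V' W h h' CV CV'; have l := subset_trans h (CU.1 V CV).
  by apply: (Runiq W l); [apply: (Rres V (CU.1 V CV))|apply: (Rres V' (CU.1 V' CV'))];
    exact: sP.
exists w => V h m' Rm; have CV : C V by exists h, m'.
move: Rm; rewrite (Prop_irrelevance h (CU.1 V CV)) wP => Rm.
exact: (Runiq _ _ _ _ (sP _ _ CV) Rm).
Qed.

Lemma rres_ext (U : opens X) (s t : O U) :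
  locally_on (fun V (h : V `<=` U) => rres h s = rres h t) -> s = t.
Proof. exact: (@mres_ext (struct_mod O)). Qed.

Lemma rres_irr (U V : opens X) (h k : V `<=` U) (s : O U) : rres h s = rres k s.
Proof. by congr (rres _ s); exact: Prop_irrelevance. Qed.

Lemma germ_irr (U : opens X) x (Ux Ux' : U x) (s : O U) : germ Ux s = germ Ux' s.
Proof. by congr germ; exact: Prop_irrelevance. Qed.

Lemma germ_eq0 (U : opens X) x (Ux : U x) (s : O U) :
  germ Ux s = 0 <-> exists (W : opens X) (h : W `<=` U), W x /\ rres h s = 0.
Proof.
rewrite -(rmorph0 (germ Ux)); split=> [/germ_inj[W [h [k [Wx e]]]]|[W [h [Wx e]]]].
  by exists W, h; split=> //; rewrite e rmorph0.
by apply/germ_inj; exists W, h, h; rewrite rmorph0.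
Qed.

Lemma basic_openP (U : opens X) (f : O U) x (Ux : U x) :
  basic_open f x <-> invertible (germ Ux f).
Proof. by split=> [[Ux' i]|]; [rewrite (germ_irr Ux Ux')|exists Ux]. Qed.

Lemma affine_inv (U : opens X) (f : O U) : affine O U ->
  invertible (rres (@basic_open_sub _ _ _ f) f).
Proof. by case=> _ _ /(_ f)[]. Qed.

Lemma affine_basis (U V : opens X) x : affine O U -> U x -> V x ->
  exists f : O U, basic_open f x /\ basic_open f `<=` V.
Proof.
move=> [_ + _] Ux Vx => /(_ (opensI U V) x (@opensIl _ U V) (conj Ux Vx)).
by case=> f [fx fUV]; exists f; split=> // y /fUV[].
Qed.

(** The local form of all sections used below: near x, finitely many sections are fractions of
    sections over U with one common denominator, a power of f. *)
Lemma affine_frac (U V : opens X) x n (s : 'I_n -> O V) :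
  affine O U -> U x -> V x ->
  exists (f : O U) (h : basic_open f `<=` V) (u : O U) (a : 'I_n -> O U),
    [/\ basic_open f x, invertible (rres (@basic_open_sub _ _ _ f) u)
      & forall i, rres (@basic_open_sub _ _ _ f) u * rres h (s i)
                  = rres (@basic_open_sub _ _ _ f) (a i)].
Proof.
move=> aU Ux Vx; have [f [fx h]] := affine_basis aU Ux Vx.
have [_ _ /(_ f)/(localization_common (fun i => rres h (s i)))[N [a aE]]] := aU.
exists f, h, (f ^+ N), a; rewrite rmorphXn; split=> //.
by apply: invertibleX; exact: affine_inv.
Qed.

Lemma affine_ker (U : opens X) (f a : O U) : affine O U ->
  rres (@basic_open_sub _ _ _ f) a = 0 -> exists n, f ^+ n * a = 0.
Proof. by case=> _ _ /(_ f)[_ _]; apply. Qed.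

End Sections.

(** * Isomorphisms of the derived category on cohomology *)

Section Cohomology.
Variables (X : topologicalType) (O : ringSheaf X).
Implicit Types (K L P : complex O) (U V W : opens X).

Lemma mresB (M : modSheaf O) U V (h : V `<=` U) (s t : M U) :
  mres h (s - t) = mres h s - mres h t.
Proof. by rewrite mresD mresN. Qed.

Lemma homB (M N : modSheaf O) (f : modHom M N) U s t :
  f U (s - t) = f U s - f U t.
Proof. exact: (linearB (hom_fun f U)). Qed.

Lemma homZ (M N : modSheaf O) (f : modHom M N) U a s :
  f U (a *: s) = a *: f U s.
Proof. exact: (linearZ_LR (hom_fun f U)). Qed.

Section Boundary.
Variables (K : complex O) (i : int).

Lemma boundary_cx_d U (t : K i U) : boundary (cx_d K i U t).
Proof.
move=> x Ux; exists U, (fun _ => id); split=> //; exists t.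
by rewrite mres_id.
Qed.

Lemma boundary0 U : boundary (0 : K (i + 1) U).
Proof. by rewrite -(hom0 (cx_d K i)); exact: boundary_cx_d. Qed.

Lemma boundaryD U (s t : K (i + 1) U) :
  boundary s -> boundary t -> boundary (s + t).
Proof.
move=> bs bt x Ux; have [V [h [Vx [s' e]]]] := bs x Ux.
have [W [k [Wx [t' e']]]] := bt x Ux.
exists (opensI V W), (subset_trans (@opensIl _ V W) h); split=> //.
exists (mres (@opensIl _ V W) s' + mres (@opensIr _ V W) t').
rewrite homD !hom_nat e e' mresD (mres_comp h _ (subset_trans (@opensIl _ V W) h)).
by rewrite (mres_comp k _ (subset_trans (@opensIl _ V W) h)).
Qed.

Lemma boundaryZ U a (s : K (i + 1) U) : boundary s -> boundary (a *: s).
Proof.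
move=> bs x Ux; have [V [h [Vx [s' e]]]] := bs x Ux.
by exists V, h; split=> //; exists (rres h a *: s'); rewrite homZ e mresZ.
Qed.

Lemma boundaryN U (s : K (i + 1) U) : boundary (- s) <-> boundary s.
Proof.
suff H (t : K (i + 1) U) : boundary t -> boundary (- t).
  by split=> [/H|/H //]; rewrite opprK.
by move/(boundaryZ (-1)); rewrite scaleN1r.
Qed.

Lemma boundaryB U (s t : K (i + 1) U) :
  boundary s -> boundary t -> boundary (s - t).
Proof. by move=> bs /boundaryN bt; exact: boundaryD. Qed.

Lemma boundary_res U V (h : V `<=` U) (s : K (i + 1) U) :
  boundary s -> boundary (mres h s).
Proof.
move=> bs x Vx; have [W [k [Wx [s' e]]]] := bs x (h x Vx).
exists (opensI V W), (@opensIl _ V W); split=> //.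
exists (mres (@opensIr _ V W) s'); rewrite hom_nat e.
rewrite (mres_comp k _ (subset_trans (@opensIr _ V W) k)).
by rewrite (mres_comp h _ (subset_trans (@opensIr _ V W) k)).
Qed.

Lemma boundary_local U (s : K (i + 1) U) :
  locally_on (fun V (h : V `<=` U) => boundary (mres h s)) -> boundary s.
Proof.
move=> bs x Ux; have [V [h [Vx b]]] := bs x Ux.
have [W [k [Wx [t e]]]] := b x Vx.
exists W, (subset_trans k h); split=> //; exists t.
by rewrite e (mres_comp h k (subset_trans k h)).
Qed.

Lemma boundary_trans U (s t u : K (i + 1) U) :
  boundary (s - t) -> boundary (t - u) -> boundary (s - u).
Proof. by move=> b b'; rewrite -(subrK t s) -addrA; exact: boundaryD. Qed.

End Boundary.

Lemma boundary_map K L (f : chainMap K L) i U (s : K (i + 1) U) :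
  boundary s -> boundary (f (i + 1) U s).
Proof.
move=> bs x Ux; have [V [h [Vx [s' e]]]] := bs x Ux.
by exists V, h; split=> //; exists (f i V s'); rewrite -cm_d e hom_nat.
Qed.

(** Quasi-isomorphisms are split into two halves because a one-sided inverse in the derived category
    controls only one of them. *)
Definition coho_inj K L (f : chainMap K L) := forall (i : int) U (s : K (i + 1) U),
  cx_d K (i + 1) U s = 0 -> boundary (f (i + 1) U s) -> boundary s.

Definition coho_surj K L (f : chainMap K L) := forall (i : int) U (t : L (i + 1) U),
  cx_d L (i + 1) U t = 0 -> locally_on (fun V (h : V `<=` U) =>
    exists s : K (i + 1) V, cx_d K (i + 1) V s = 0 /\
      boundary (mres h t - f (i + 1) V s)).

Lemma quasi_isoP K L (f : chainMap K L) :
  quasi_iso f <-> coho_inj f /\ coho_surj f.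
Proof.
split=> [qf|[fi fs] i]; first by split=> i U s; [exact: (qf i).1|exact: (qf i).2].
by split=> U s; [exact: fi|exact: fs].
Qed.

Lemma cm_cocycle K L (f : chainMap K L) i U (s : K i U) :
  cx_d K i U s = 0 -> cx_d L i U (f i U s) = 0.
Proof. by rewrite -cm_d => ->; rewrite hom0. Qed.

Lemma res_cocycle K i U V (h : V `<=` U) (s : K i U) :
  cx_d K i U s = 0 -> cx_d K i V (mres h s) = 0.
Proof. by rewrite hom_nat => ->; rewrite mres0. Qed.

Lemma coho_surj_r K L P (g : chainMap L P) (f : chainMap K L) :
  coho_surj (cm_comp g f) -> coho_surj g.
Proof.
move=> gf i U t dt x Ux; have [V [h [Vx [s [ds bs]]]]] := gf i U t dt x Ux.
exists V, h; split=> //; exists (f (i + 1) V s); split=> //; exact: cm_cocycle.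
Qed.

Lemma coho_inj_l K L P (g : chainMap L P) (f : chainMap K L) :
  coho_inj (cm_comp g f) -> coho_inj f.
Proof. by move=> gf i U s ds /(boundary_map g); exact: gf. Qed.

Lemma coho_inj_comp K L P (g : chainMap L P) (f : chainMap K L) :
  coho_inj g -> coho_inj f -> coho_inj (cm_comp g f).
Proof. by move=> gi fi i U s ds /gi b; apply: fi => //; apply/b/cm_cocycle. Qed.

Lemma coho_surj_comp K L P (g : chainMap L P) (f : chainMap K L) :
  coho_surj g -> coho_surj f -> coho_surj (cm_comp g f).
Proof.
move=> gs fs i U t dt x Ux; have [V [h [Vx [s [ds bs]]]]] := gs i U t dt x Ux.
have [W [k [Wx [r [dr br]]]]] := fs i V s ds x Vx.
exists W, (subset_trans k h); split=> //; exists r; split=> //.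
apply: (@boundary_trans _ _ _ _ (g (i + 1) W (mres k s))).
  by rewrite hom_nat -(mres_comp h k) -mresB; exact: boundary_res.
by rewrite /= -homB; exact: boundary_map.
Qed.

Lemma coho_surj_cancel K L P (g : chainMap L P) (f : chainMap K L) :
  coho_inj g -> coho_surj (cm_comp g f) -> coho_surj f.
Proof.
move=> gi gf i U t dt x Ux.
have [V [h [Vx [s [ds bs]]]]] := gf i U _ (cm_cocycle g dt) x Ux.
exists V, h; split=> //; exists s; split=> //; apply: gi.
  by rewrite homB (res_cocycle _ dt) (cm_cocycle f ds) subr0.
by rewrite homB hom_nat.
Qed.

Lemma coho_inj_cancel K L P (g : chainMap L P) (f : chainMap K L) :
  coho_surj f -> coho_inj (cm_comp g f) -> coho_inj g.
Proof.
move=> fs gf i U t dt bt; apply: boundary_local => x Ux.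
have [V [h [Vx [s [ds bs]]]]] := fs i U t dt x Ux.
exists V, h; split=> //; rewrite -(subrK (f (i + 1) V s) (mres h t)).
apply: boundaryD => //; apply: boundary_map; apply: gf => //=.
rewrite -[g _ _ _](subKr (mres h (g (i + 1) U t))); apply: boundaryB.
  exact: boundary_res.
by rewrite -hom_nat -homB; exact: boundary_map.
Qed.

Lemma homotopic_boundary K L (f g : chainMap K L) i U (s : K (i + 1) U) :
  homotopic f g -> cx_d K (i + 1) U s = 0 ->
  boundary (f (i + 1) U s - g (i + 1) U s).
Proof. by move=> [h ->] ->; rewrite hom0 addr0; exact: boundary_cx_d. Qed.

Lemma eq_homotopic K L (f g : chainMap K L) :
  (forall i U s, f i U s = g i U s) -> homotopic f g.
Proof.
move=> fg; exists (fun i => hom_zero _ _) => i U s.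
by rewrite fg subrr /= hom0 addr0.
Qed.

Lemma homotopic_coho_inj K L (f g : chainMap K L) :
  homotopic f g -> coho_inj f -> coho_inj g.
Proof.
move=> fg fi i U s ds bs; apply: fi => //.
rewrite -(subrK (g (i + 1) U s) (f (i + 1) U s)); apply: boundaryD => //.
exact: homotopic_boundary.
Qed.

Lemma homotopic_coho_surj K L (f g : chainMap K L) :
  homotopic f g -> coho_surj f -> coho_surj g.
Proof.
move=> fg fs i U t dt x Ux; have [V [h [Vx [s [ds bs]]]]] := fs i U t dt x Ux.
exists V, h; split=> //; exists s; split=> //.
exact: boundary_trans bs (homotopic_boundary fg ds).
Qed.

(** The roof equality supplies [v] with both composites homotopic to the quasi-isomorphism [u].
    Cancellation makes [v] surjective on cohomology, hence [cm_comp (right_leg b) h] bijective. So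
    [h] is injective, and the commuting square passes this to [right_leg a], since [r] is
    surjective. *)
Lemma roof_comp_id K L (a : roof K L) (b : roof L K) :
  roof_comp a b (roof_id K) -> coho_inj (right_leg a) /\ coho_surj (right_leg b).
Proof.
move=> [V [r [h [q [hom [Z [u [v [qu uv1 uv2]]]]]]]]].
have /quasi_isoP[qi qs] := q; have [ai as_] := (quasi_isoP _).1 (left_qis a).
have [bi _] := (quasi_isoP _).1 (left_qis b).
have /quasi_isoP[ui us] := qu.
have vs : coho_surj v.
  exact: coho_surj_cancel qi (homotopic_coho_surj uv1 us).
have bhs : coho_surj (cm_comp (right_leg b) h).
  exact: coho_surj_r (homotopic_coho_surj uv2 us).
have bhi : coho_inj (cm_comp (right_leg b) h).
  exact: coho_inj_cancel vs (homotopic_coho_inj uv2 ui).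
split; last exact: coho_surj_r bhs.
have rs : coho_surj r by exact: coho_surj_cancel ai qs.
apply: (coho_inj_cancel rs); apply: (homotopic_coho_inj hom).
exact: coho_inj_comp bi (coho_inj_l bhi).
Qed.

Lemma derived_iso_roof K L : derived_iso K L ->
  exists (Z : complex O) (f : chainMap Z K) (g : chainMap Z L),
    quasi_iso f /\ quasi_iso g.
Proof.
move=> [a [b [ab ba]]]; exists (apex a), (left_leg a), (right_leg a).
split; first exact: left_qis.
by apply/quasi_isoP; split; [case: (roof_comp_id ab)|case: (roof_comp_id ba)].
Qed.

Lemma derived_iso_sym K L : derived_iso K L -> derived_iso L K.
Proof. by move=> [a [b [ab ba]]]; exists b, a. Qed.

Lemma quasi_iso_derived K L (f : chainMap K L) :
  quasi_iso f -> derived_iso K L.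
Proof.
move=> qf; exists (Roof (@quasi_iso_id _ _ K) f), (Roof qf (cm_id K)).
split.
  exists K, (cm_id K), (cm_id K), (@quasi_iso_id _ _ K).
  split; first exact: eq_homotopic.
  by exists K, (cm_id K), (cm_id K); split;
    [exact: quasi_iso_id|exact: eq_homotopic|exact: eq_homotopic].
exists K, (cm_id K), (cm_id K), qf.
split; first exact: eq_homotopic.
by exists K, f, (cm_id K); split=> //; exact: eq_homotopic.
Qed.

Program Definition cm_fst K L : chainMap (sum_cx K L) K :=
  @ChainMap _ _ (sum_cx K L) K
    (fun i => @ModHom X O (sum_mod (K i) (L i)) (K i) (fun U s => s.1) _ _) _.
Next Obligation. by []. Qed.
Next Obligation. by []. Qed.
Next Obligation. by []. Qed.

Lemma coho_surj_fst K L : coho_surj (cm_fst K L).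
Proof.
move=> i U t dt x Ux; exists U, (fun _ => id); split=> //; exists (t, 0).
split; first by rewrite /= dt hom0.
by rewrite mres_id subrr; exact: boundary0.
Qed.

Lemma boundary_sum K L i U (s : K (i + 1) U) (t : L (i + 1) U) :
  boundary s -> boundary t -> boundary ((s, t) : sum_cx K L (i + 1) U).
Proof.
move=> bs bt x Ux; have [V [h [Vx [s' e]]]] := bs x Ux.
have [W [k [Wx [t' e']]]] := bt x Ux.
exists (opensI V W), (subset_trans (@opensIl _ V W) h); split=> //.
exists (mres (@opensIl _ V W) s', mres (@opensIr _ V W) t').
rewrite /= !hom_nat e e' (mres_comp h _ (subset_trans (@opensIl _ V W) h)).
by rewrite (mres_comp k _ (subset_trans (@opensIl _ V W) h)).
Qed.

Lemma boundary_shift K i U (s : K (i + 1 + 1) U) :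
  @boundary _ _ (shift K) i U s <-> boundary s.
Proof.
by split=> bs x Ux; have [V [h [Vx [t e]]]] := bs x Ux; exists V, h; split=> //;
  exists (- t); move: e; rewrite /= homN ?opprK.
Qed.

Section Divisibility.
Variables (U : opens X) (a b : O U).

(* For every cohomology sheaf H of K restricted to U, a H <= b H.             *)
Definition coho_div K := forall (i : int) V (h : V `<=` U) (s : K (i + 1) V),
  cx_d K (i + 1) V s = 0 -> locally_on (fun W (k : W `<=` V) =>
    exists t : K (i + 1) W, cx_d K (i + 1) W t = 0 /\
      boundary (rres (subset_trans k h) a *: mres k s
                - rres (subset_trans k h) b *: t)).

(** The property a H <= b H is inherited by quotients of H. Through the projection [cm_fst] this
    settles direct summands. *)
Lemma coho_div_surj K L (f : chainMap K L) :
  coho_surj f -> coho_div K -> coho_div L.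
Proof.
move=> fs Kd i V h t dt x Vx; have [W [k [Wx [s [ds bs]]]]] := fs i V t dt x Vx.
have [W' [l [W'x [s' [ds' bs']]]]] := Kd i W (subset_trans k h) s ds x Wx.
exists W', (subset_trans l k); split=> //; exists (f (i + 1) W' s').
split; first exact: cm_cocycle.
rewrite !(rres_irr (subset_trans _ h) (subset_trans l (subset_trans k h))).
set a' := rres _ a; set b' := rres _ b.
apply: (@boundary_trans _ _ _ _ (a' *: mres l (f (i + 1) W s))).
  by rewrite -scalerBr -(mres_comp k l) -mresB; apply: boundaryZ; exact: boundary_res.
by rewrite -hom_nat -!homZ -homB; exact: boundary_map.
Qed.

Lemma coho_div_inj K L (f : chainMap K L) :
  quasi_iso f -> coho_div L -> coho_div K.
Proof.
move=> /quasi_isoP[fi fs] Ld i V h s ds x Vx.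
have [W [k [Wx [t [dt bt]]]]] := Ld i V h _ (cm_cocycle f ds) x Vx.
have [W' [l [W'x [s' [ds' bs']]]]] := fs i W t dt x Wx.
exists W', (subset_trans l k); split=> //; exists s'; split=> //.
apply: fi.
  by rewrite homB !homZ (res_cocycle _ ds) ds' !scaler0 subr0.
rewrite homB !homZ hom_nat.
apply: (@boundary_trans _ _ _ _ (rres (subset_trans (subset_trans l k) h) b *: mres l t)).
  move: (boundary_res l bt); rewrite mresB !mresZ (mres_comp k l (subset_trans l k)).
  by rewrite !(rres_comp _ l (subset_trans (subset_trans l k) h)).
by rewrite -scalerBr; exact: boundaryZ.
Qed.

Lemma coho_div_derived_iso K L : derived_iso K L -> coho_div K -> coho_div L.
Proof.
move=> /derived_iso_roof[Z [f [g [qf /quasi_isoP[_ gs]]]]] Kd.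
exact: coho_div_surj gs (coho_div_inj qf Kd).
Qed.

Lemma coho_div_zero : coho_div (zero_cx O).
Proof.
move=> i V h s _ x Vx; exists V, (fun _ => id); split=> //; exists 0.
by split=> //=; rewrite [_ - _]thinmx0; exact: (@boundary0 (zero_cx O)).
Qed.

Lemma coho_div_sum K L : coho_div K -> coho_div L -> coho_div (sum_cx K L).
Proof.
move=> Kd Ld i V h [s t] /= [ds dt] x Vx.
have [W [k [Wx [s' [ds' bs']]]]] := Kd i V h s ds x Vx.
have [W' [l [W'x [t' [dt' bt']]]]] :=
  Ld i W (subset_trans k h) _ (res_cocycle k dt) x Wx.
exists W', (subset_trans l k); split=> //; exists (mres l s', t').
split; first by rewrite /= dt' (res_cocycle l ds').
apply: boundary_sum => /=.
  move: (boundary_res l bs'); rewrite mresB !mresZ (mres_comp k l (subset_trans l k)).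
  by rewrite !(rres_comp _ l (subset_trans (subset_trans l k) h)).
rewrite -(mres_comp k l).
by rewrite !(rres_irr (subset_trans _ h) (subset_trans l (subset_trans k h))).
Qed.

Lemma coho_div_shift K : coho_div K <-> coho_div (shift K).
Proof.
split=> Kd i V h s ds x Vx.
  have ds' : cx_d K (i + 1 + 1) V s = 0 by apply: oppr_inj; rewrite oppr0.
  have [W [k [Wx [t [dt bt]]]]] := Kd (i + 1) V h s ds' x Vx.
  exists W, k; split=> //; exists t; split; first by rewrite /= dt oppr0.
  exact/boundary_shift.
(* Only when i is literally a successor is [K (i + 1)] a term of [shift K]. *)
have [j ij] : exists j, i = j + 1 by exists (i - 1); rewrite subrK.
move: s ds; rewrite ij => s ds.
have ds' : cx_d (shift K) (j + 1) V s = 0 by rewrite /= ds oppr0.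
have [W [k [Wx [t [dt bt]]]]] := Kd j V h s ds' x Vx.
exists W, k; split=> //; exists t; split; last exact/boundary_shift.
by apply: oppr_inj; rewrite oppr0.
Qed.

Lemma coho_div_add (T S : complex O -> Prop) K :
  (forall L, S L -> coho_div L) -> Defs.add T S K -> coho_div K.
Proof.
move=> Sd; elim=> {K} [K _|K L KL _|||K _|K _|K L _ _ _].
- exact: Sd.
- exact: coho_div_derived_iso KL.
- exact: coho_div_zero.
- by move=> K L _ Kd _ Ld; exact: coho_div_sum.
- by case: (coho_div_shift K).
- by case: (coho_div_shift K).
- exact: coho_div_surj (@coho_surj_fst K L).
Qed.

End Divisibility.

End Cohomology.

(** * Invariance of bounded coherent cohomology *)

Section Kernel.
Variables (X : topologicalType) (O : ringSheaf X) (M N : modSheaf O).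
Variable f : modHom M N.

Section Sections.
Variable U : opens X.

Definition ker_pred : {pred M U} := fun s => `[< f U s = 0 >].

Lemma ker_predP s : (s \in ker_pred) = `[< f U s = 0 >]. Proof. by []. Qed.

Fact ker_submod_closed : submod_closed ker_pred.
Proof.
split=> [|a s t]; rewrite !ker_predP; first by apply/asboolP; exact: hom0.
by move=> /asboolP fs /asboolP ft; apply/asboolP; rewrite hom_lin fs ft scaler0 addr0.
Qed.
HB.instance Definition _ :=
  GRing.isSubmodClosed.Build _ _ ker_pred ker_submod_closed.

Record ker_sec := KerSec { ker_val : M U; ker_valP : ker_val \in ker_pred }.
HB.instance Definition _ := [isSub for ker_val].
HB.instance Definition _ := [Choice of ker_sec by <:].
HB.instance Definition _ := [SubChoice_isSubLmodule of ker_sec by <:].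

Lemma ker_val_lin a (s t : ker_sec) :
  ker_val (a *: s + t) = a *: ker_val s + ker_val t.
Proof. exact: (linearP (val : ker_sec -> M U)). Qed.

Lemma ker_val0 (z : ker_sec) : f U (ker_val z) = 0.
Proof. by apply/asboolP; exact: ker_valP. Qed.

Definition ker_of s (fs : f U s = 0) : ker_sec := KerSec (introT (asboolP _) fs).

End Sections.

Lemma ker_resP (U V : opens X) (h : V `<=` U) (z : ker_sec U) :
  f V (mres h (ker_val z)) = 0.
Proof. by rewrite hom_nat ker_val0 mres0. Qed.

(** Supplies the sheaf of cocycles that [is_cohomology] asks for. *)
Program Definition ker_mod : modSheaf O :=
  @ModSheaf X O (fun U => ker_sec U) (fun U V h z => ker_of (ker_resP h z)) _ _ _ _.
Next Obligation.
move=> U V h a s t; apply: val_inj; apply: etrans (esym (ker_val_lin _ _ _)).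
exact: etrans (congr1 (mres h) (ker_val_lin a s t)) (mres_lin h _ _ _).
Qed.
Next Obligation. by move=> U h s; apply: val_inj; exact: mres_id. Qed.
Next Obligation. by move=> U V W h k l s; apply: val_inj; exact: mres_comp. Qed.
Next Obligation.
move=> U C s CU cpt.
have [V V' W h h' CV CV'|t [tE tu]] :=
    @mres_sheaf _ _ M U C (fun V => ker_val (s V)) CU.
  exact: (congr1 (@ker_val W) (cpt V V' W h h' CV CV')).
have ft : f U t = 0.
  apply: mres_ext => x /CU.2[V CV Vx]; exists V, (CU.1 V CV); split=> //.
  by rewrite -hom_nat tE ker_val0 mres0.
exists (ker_of ft); split=> [V CV|t' e]; apply: val_inj => /=; first exact: tE.
by apply: tu => V CV; rewrite -e.
Qed.

Program Definition ker_incl : modHom ker_mod M :=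
  @ModHom X O ker_mod M (fun U z => ker_val z) _ _.
Next Obligation. by move=> U a s t; exact: ker_val_lin. Qed.
Next Obligation. by []. Qed.

End Kernel.

Section CohomologySheaf.
Variables (X : topologicalType) (O : ringSheaf X).
Implicit Types (K L Z : complex O) (H : modSheaf O) (U V W : opens X) (i : int).

(* The values of p outside the cocycles are junk.                             *)
Definition coho_map K i H (p : forall U, K (i + 1) U -> H U) :=
  [/\ forall U a s t, cx_d K (i + 1) U s = 0 -> cx_d K (i + 1) U t = 0 ->
        p U (a *: s + t) = a *: p U s + p U t,
      forall U V (h : V `<=` U) s, cx_d K (i + 1) U s = 0 ->
        p V (mres h s) = mres h (p U s),
      forall U (t : H U), locally_on (fun V (h : V `<=` U) =>
        exists s, cx_d K (i + 1) V s = 0 /\ p V s = mres h t)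
    & forall U s, cx_d K (i + 1) U s = 0 -> (p U s = 0 <-> boundary s)].

(** Trades the sheaf of cocycles for a map defined on cocycles, which can be moved from one complex
    to another without comparing kernels. *)
Lemma is_cohomologyP K i H :
  is_cohomology K i H <-> exists p : forall U, K (i + 1) U -> H U, coho_map p.
Proof.
split=> [[Z [iota [pi [inj rng sur ker]]]]|[p [lin nat sur ker]]].
  have Zof U (s : K (i + 1) U) : cx_d K (i + 1) U s = 0 -> exists z, iota U z = s.
    move=> ds; have : range (iota U) s by rewrite rng.
    by case=> z _ <-; exists z.
  pose p U (s : K (i + 1) U) : H U :=
    if pselect (exists z, iota U z = s) is left ex then pi U (projT1 (cid ex)) else 0.
  have pE U z : p U (iota U z) = pi U z.
    rewrite /p; case: pselect => [ex|[]]; last by exists z.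
    by case: cid => z' /= /inj ->.
  exists p; split=> [U a s t|U V h s|U t x Ux|U s].
  - by move=> /Zof[z <-] /Zof[w <-]; rewrite -hom_lin !pE hom_lin.
  - by move=> /Zof[z <-]; rewrite -hom_nat !pE hom_nat.
  - have [V [h [Vx [z e]]]] := sur U t x Ux; exists V, h; split=> //.
    exists (iota V z); rewrite pE; split=> //.
    have : range (iota V) (iota V z) by exists z.
    by rewrite rng.
  - by move=> /Zof[z <-]; rewrite pE; exact: ker.
pose d := cx_d K (i + 1).
have pl U : linear (fun z : ker_mod d U => p U (ker_val z)).
  move=> a s t; apply: etrans (congr1 (p U) (ker_val_lin a s t)) _.
  by apply: lin; exact: ker_val0.
have pn U V (h : V `<=` U) (z : ker_mod d U) :
    p V (ker_val (mres h z)) = mres h (p U (ker_val z)).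
  by rewrite -nat //; exact: ker_val0.
exists (ker_mod d), (ker_incl d), (ModHom pl pn); split=> /=.
- by move=> U z w; exact: val_inj.
- move=> U; apply/seteqP; split=> [_ [z _ <-]|s ds] /=; first exact: ker_val0.
  by exists (ker_of ds).
- move=> U t x Ux; have [V [h [Vx [s [ds e]]]]] := sur U t x Ux.
  by exists V, h; split=> //; exists (ker_of ds).
- by move=> U z; apply: ker; exact: ker_val0.
Qed.

Section Transport.
Variables (K L Z : complex O) (f : chainMap Z K) (g : chainMap Z L).
Hypotheses (qf : quasi_iso f) (qg : quasi_iso g).
Variables (i : int) (H : modSheaf O) (p : forall U, K (i + 1) U -> H U).
Hypothesis pP : coho_map p.

(* The class of l comes from a class of Z with image m in H.                  *)
Let coho_rel U (l : L (i + 1) U) (m : H U) :=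
  locally_on (fun V (h : V `<=` U) => exists z : Z (i + 1) V,
    [/\ cx_d Z (i + 1) V z = 0, boundary (mres h l - g (i + 1) V z)
      & mres h m = p (f (i + 1) V z)]).

Let coho_rel_at U l m (z : Z (i + 1) U) : cx_d Z (i + 1) U z = 0 ->
  boundary (l - g (i + 1) U z) -> m = p (f (i + 1) U z) -> coho_rel l m.
Proof.
move=> dz bz mE x Ux; exists U, (fun _ => id); split=> //; exists z.
by rewrite !mres_id.
Qed.

Let coho_rel_res U V (h : V `<=` U) l m :
  coho_rel l m -> coho_rel (mres h l) (mres h m).
Proof.
case: pP => _ nat _ _ lm x Vx; have [W [k [Wx [z [dz bz e]]]]] := lm x (h x Vx).
have hVW := subset_trans (@opensIl _ V W) h.
exists (opensI V W), (@opensIl _ V W); split=> //.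
exists (mres (@opensIr _ V W) z); split; first exact: res_cocycle.
  move: (boundary_res (@opensIr _ V W) bz); rewrite hom_nat mresB.
  by rewrite (mres_comp k _ hVW) (mres_comp h _ hVW).
rewrite hom_nat nat -?e; last exact: cm_cocycle.
by rewrite (mres_comp k _ hVW) (mres_comp h _ hVW).
Qed.

Let coho_rel_local U l m :
  locally_on (fun V (h : V `<=` U) => coho_rel (mres h l) (mres h m)) ->
  coho_rel l m.
Proof.
move=> lm x Ux; have [V [h [Vx r]]] := lm x Ux.
have [W [k [Wx [z [dz bz e]]]]] := r x Vx.
exists W, (subset_trans k h); split=> //; exists z.
by rewrite -!(mres_comp h k).
Qed.

Let coho_rel_lin U a (l l' : L (i + 1) U) m m' :
  coho_rel l m -> coho_rel l' m' -> coho_rel (a *: l + l') (a *: m + m').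
Proof.
case: pP => lin nat _ _ r r'; apply: coho_rel_local => x Ux.
have [V [h [Vx [z [dz bz e]]]]] := r x Ux.
have [W [k [Wx [z' [dz' bz' e']]]]] := coho_rel_res h r' Vx.
exists W, (subset_trans k h); split=> //.
pose b := rres (subset_trans k h) a.
apply: (@coho_rel_at _ _ _ (b *: mres k z + z')).
- by rewrite hom_lin (res_cocycle k dz) dz' scaler0 addr0.
- rewrite mres_lin hom_lin hom_nat opprD addrACA -scalerBr; apply: boundaryD.
    by rewrite -(mres_comp h k) -mresB; apply: boundaryZ; exact: boundary_res.
  by rewrite -(mres_comp h k).
- rewrite mres_lin hom_lin lin; try exact: cm_cocycle.
    by rewrite hom_nat nat -?(mres_comp h k) ?e ?e' //; exact: cm_cocycle.
  by apply: cm_cocycle; exact: res_cocycle.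
Qed.

(** Both implications chase the intermediate cocycle z: one uses injectivity of f on cohomology, the
    other that of g. By linearity this also gives uniqueness of m. *)
Let coho_rel_eq0 U (l : L (i + 1) U) m : coho_rel l m -> (m = 0 <-> boundary l).
Proof.
case: pP => _ _ _ ker r; move/quasi_isoP: qf => [fi _]; move/quasi_isoP: qg => [gi _].
split=> [m0|bl].
  apply: boundary_local => x Ux; have [V [h [Vx [z [dz bz e]]]]] := r x Ux.
  exists V, h; split=> //; rewrite -(subrK (g (i + 1) V z) (mres h l)).
  apply: boundaryD => //; apply: boundary_map; apply: fi => //.
  by apply/ker; [exact: cm_cocycle|rewrite -e m0 mres0].
apply: mres_ext => x Ux; have [V [h [Vx [z [dz bz e]]]]] := r x Ux.
exists V, h; split=> //; rewrite mres0 e; apply/ker; first exact: cm_cocycle.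
apply: boundary_map; apply: gi => //.
rewrite -[g _ _ _](subKr (mres h l)); apply: boundaryB => //.
exact: boundary_res.
Qed.

Let coho_rel_uniq U (l : L (i + 1) U) m m' :
  coho_rel l m -> coho_rel l m' -> m = m'.
Proof.
move=> r r'; have := coho_rel_eq0 (coho_rel_lin (-1) r' r).
rewrite !scaleN1r addNr => -[_ /(_ (@boundary0 _ _ _ _ _))].
by rewrite addrC => /eqP; rewrite subr_eq0 => /eqP.
Qed.

(** Surjectivity of g on cohomology gives m locally; uniqueness lets the local values glue. *)
Let coho_rel_ex U (l : L (i + 1) U) :
  cx_d L (i + 1) U l = 0 -> exists m, coho_rel l m.
Proof.
move=> dl; move/quasi_isoP: qg => [_ gs].
have [||x Ux|m mE] := @mres_glue _ _ H U (fun V h m => coho_rel (mres h l) m).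
- by move=> V h m m'; exact: coho_rel_uniq.
- by move=> V h W k k' m /(coho_rel_res k); rewrite (mres_comp h k k').
- have [V [h [Vx [z [dz bz]]]]] := gs i U l dl x Ux.
  by exists V, h; split=> //; exists (p (f (i + 1) V z)); exact: coho_rel_at dz bz _.
exists m; apply: coho_rel_local => x Ux.
have [V [h [Vx [z [dz bz]]]]] := gs i U l dl x Ux.
have r : coho_rel (mres h l) (p (f (i + 1) V z)) by exact: coho_rel_at dz bz _.
by exists V, h; split=> //; rewrite (mE V h _ r).
Qed.

Lemma coho_map_transport :
  exists q : forall U, L (i + 1) U -> H U, coho_map q.
Proof.
case: (pP) => _ nat sur _; move/quasi_isoP: (qf) => [_ fs].
pose q U (l : L (i + 1) U) : H U :=
  if pselect (exists m, coho_rel l m) is left ex then projT1 (cid ex) else 0.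
have qE U (l : L (i + 1) U) m : coho_rel l m -> q U l = m.
  move=> r; rewrite /q; case: pselect => [ex|[]]; last by exists m.
  by case: cid => m' /= r'; exact: coho_rel_uniq r' r.
exists q; split=> [U a s t|U V h s|U t x Ux|U s].
- move=> /coho_rel_ex[m r] /coho_rel_ex[m' r'].
  by rewrite (qE _ _ _ r) (qE _ _ _ r'); apply: qE; exact: coho_rel_lin.
- move=> /coho_rel_ex[m r]; rewrite (qE _ _ _ r); apply: qE.
  exact: coho_rel_res.
- have [V [h [Vx [s [ds e]]]]] := sur U t x Ux.
  have [W [k [Wx [z [dz bz]]]]] := fs i V s ds x Vx.
  exists W, (subset_trans k h); split=> //; exists (g (i + 1) W z).
  split; first exact: cm_cocycle.
  apply: qE; apply: (coho_rel_at dz); first by rewrite subrr; exact: boundary0.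
  rewrite -(mres_comp h k) -e -nat //.
  have ds' := res_cocycle k ds; have dz' := cm_cocycle f dz.
  have [lin _ _ ker] := pP; apply/eqP; rewrite -subr_eq0 addrC -scaleN1r.
  rewrite -lin //; apply/eqP/ker; first by rewrite hom_lin ds' dz' scaler0 addr0.
  by rewrite scaleN1r addrC.
- by move=> /coho_rel_ex[m r]; rewrite (qE _ _ _ r); exact: coho_rel_eq0.
Qed.

End Transport.

Lemma Dbcoh_derived_iso K L : derived_iso K L -> Dbcoh K -> Dbcoh L.
Proof.
move=> /derived_iso_roof[Z [f [g [qf qg]]]] [[N bK] cK]; split.
  exists N => i U s iN ds; apply: boundary_local => x Ux.
  move/quasi_isoP: qf => [fi _]; move/quasi_isoP: qg => [_ gs].
  have [V [h [Vx [z [dz bz]]]]] := gs i U s ds x Ux.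
  exists V, h; split=> //; rewrite -(subrK (g (i + 1) V z) (mres h s)).
  apply: boundaryD => //; apply: boundary_map; apply: fi => //.
  by apply: bK => //; exact: cm_cocycle.
move=> i; have [H [/is_cohomologyP[p pP] cH]] := cK i.
by exists H; split=> //; apply/is_cohomologyP; exact: coho_map_transport qf qg _ _ _ pP.
Qed.

End CohomologySheaf.

(** * The generic stalk of an integral scheme *)

Section FieldOfInvertible.
Variables (A : comPzRingType) (A1 : (1 : A) <> 0).
Hypothesis Ainv : forall a : A, a <> 0 -> invertible a.

(* The two proofs are arguments of the type so that its field structure,      *)
(* which needs them, can be inferred.                                         *)
Definition field_of of (1 : A) <> 0 & (forall a : A, a <> 0 -> invertible a) : Type := A.
Local Notation F := (field_of A1 Ainv).

HB.instance Definition _ := GRing.ComPzRing.on F.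
HB.instance Definition _ := GRing.PzSemiRing_isNonZero.Build F (introN eqP A1).

Let inv (a : F) : F :=
  if pselect (invertible (a : A)) is left i then projT1 (cid i) else 0.

Let mulVf (a : F) : a != 0 -> inv a * a = 1.
Proof.
move/eqP/Ainv => i; rewrite /inv; case: pselect => [j|/(_ i)//].
by case: cid => b /= <-; rewrite mulrC.
Qed.

Let inv0 : inv 0 = 0.
Proof.
rewrite /inv; case: pselect => // i; exfalso.
by case: i => b; rewrite mul0r => /esym.
Qed.

HB.instance Definition _ := GRing.ComNzRing_isField.Build F mulVf inv0.

End FieldOfInvertible.

Section Scheme.
Variable X : scheme.
Local Notation O := (str_sheaf X).
Implicit Types U V W : opens X.

Lemma invertible_germ U x (Ux : U x) (a : O U) : invertible (germ Ux a) ->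
  exists V (h : V `<=` U), V x /\ invertible (rres h a).
Proof.
move=> [b]; have [V [Vx [t ->]]] := germP b.
have Wx : opensI U V x by split.
rewrite -(germ_res Ux Wx (@opensIl _ U V)) -(germ_res Vx Wx (@opensIr _ U V)).
rewrite -rmorphM -(rmorph1 (germ Wx)) => /germ_inj[W [h [k [W'x]]]].
rewrite rmorphM rmorph1 => e.
exists W, (subset_trans h (@opensIl _ U V)); split=> //.
by exists (rres h (rres (@opensIr _ U V) t)); rewrite -(rres_comp (@opensIl _ U V) h).
Qed.

Lemma germ_neq1 x : (1 : stalk O x) <> 0.
Proof. by case: (sch_local x). Qed.

Lemma vanishing_prime U x : U x -> prime_ideal [set f : O U | ~ basic_open f x].
Proof.
move=> Ux; have [n1 loc] := sch_local x.
have -> : [set f : O U | ~ basic_open f x] = [set f | ~ invertible (germ Ux f)].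
  by apply/seteqP; split=> f /= nf; [move/(basic_openP _ Ux)|move/(basic_openP _ Ux)].
split=> [||a b /=].
- split=> [|a b|a b] /=.
  + by rewrite rmorph0 => -[b]; rewrite mul0r => /esym.
  + by rewrite rmorphD => na nb /loc[].
  + by rewrite rmorphM invertibleM => nb [].
- by rewrite /= rmorph1; apply; exists 1; rewrite mulr1.
- by rewrite rmorphM invertibleM => ab; apply/not_andP.
Qed.

Lemma affine_germ_frac U x (Ux : U x) (b : stalk O x) : affine O U ->
  exists u a : O U, invertible (germ Ux u) /\ germ Ux u * b = germ Ux a.
Proof.
move=> aU; have [V [Vx [s ->]]] := germP b.
have [f [h [u [a [fx iu uE]]]]] := affine_frac (fun _ : 'I_1 => s) aU Ux Vx.
exists u, (a ord0); rewrite -!(germ_res Ux fx (@basic_open_sub _ _ _ f)).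
split; first exact: invertible_morph.
by rewrite -(germ_res Vx fx h) -rmorphM (uE ord0).
Qed.

Lemma affine_germ_common U x (Ux : U x) n (b : 'I_n -> stalk O x) : affine O U ->
  exists (u : O U) (a : 'I_n -> O U),
    invertible (germ Ux u) /\ forall i, germ Ux u * b i = germ Ux (a i).
Proof.
move=> aU; elim: n b => [|n IH] b.
  by exists 1, (fun=> 0); split=> [|[]//]; rewrite rmorph1; exists 1; rewrite mulr1.
have [u [a [iu ua]]] := IH (fun i => b (lift ord0 i)).
have [v [c [iv vc]]] := affine_germ_frac Ux (b ord0) aU.
exists (u * v), (fun i => if unlift ord0 i is Some j then v * a j else u * c).
split=> [|i]; first by rewrite rmorphM invertibleM.
by case: unliftP => [j ->|->]; rewrite !rmorphM /=; [rewrite -ua mulrCA|rewrite -vc];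
  rewrite mulrA.
Qed.

Section Integral.
Variables (eta : X).
Hypotheses (X_int : integral_scheme X) (eta_dense : closure [set eta] = [set: X]).

Lemma generic_in U x : U x -> U eta.
Proof.
move=> Ux; have : closure [set eta] x by rewrite eta_dense.
by move=> /(_ U (open_nbhs_nbhs (conj (open_oset U) Ux)))[y [->]].
Qed.

Lemma integral_mulf U x (a b : O U) : U x -> a * b = 0 -> a = 0 \/ b = 0.
Proof. by move=> Ux; have [_] := X_int.2 U (ex_intro _ x Ux); apply. Qed.

Lemma integral_expf_mul U x (a b : O U) n : U x -> a <> 0 -> a ^+ n * b = 0 -> b = 0.
Proof.
move=> Ux na; elim: n => [|n IH]; first by rewrite mul1r.
by rewrite exprS -mulrA => /(integral_mulf Ux)[].
Qed.

Lemma integral_stalk x : integral_domain (stalk O x).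
Proof.
split=> [|a b]; first exact: germ_neq1.
have [U [Ux [s [t [-> ->]]]]] := germP2 a b.
rewrite -rmorphM => /germ_eq0[W [h [Wx]]]; rewrite rmorphM.
by case/(integral_mulf Wx) => e; [left|right]; apply/germ_eq0; exists W, h.
Qed.

(** The generic point lies in every nonempty open, so U is empty. *)
Lemma empty_sections U (s t : O U) : ~ U eta -> s = t.
Proof. by move=> nU; apply: rres_ext => x /generic_in. Qed.

(** Otherwise D(a) is empty, so 1 = 0 over it, and the localization property makes a nilpotent in a
    domain. *)
Lemma basic_open_generic U (a : O U) : affine O U -> a <> 0 -> basic_open a eta.
Proof.
move=> aU na; apply: contrapT => ne.
have Ue : U eta.
  by apply: contrapT => nU; apply: na; exact: empty_sections.
have [n] := affine_ker aU (empty_sections (rres (@basic_open_sub _ _ _ a) 1) 0 ne).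
by move/(integral_expf_mul Ue na); have [] := X_int.2 U (ex_intro _ _ Ue).
Qed.

Lemma affine_germ_eq0 U (Ue : U eta) (a : O U) :
  affine O U -> germ Ue a = 0 -> a = 0.
Proof.
move=> aU g0; apply: contrapT => /(basic_open_generic aU)/(basic_openP _ Ue).
by rewrite g0 => -[b]; rewrite mul0r => /esym; exact: germ_neq1.
Qed.

(** Over an affine open this is [basic_open_generic]; a general section is locally a fraction with
    unit denominator, which reduces to that case. *)
Lemma germ_generic_eq0 U (Ue : U eta) (s : O U) : germ Ue s = 0 -> s = 0.
Proof.
move=> g0; apply: rres_ext => x Ux; have [U' [U'x aU']] := sch_affine x.
have [f [h [u [a [fx iu uE]]]]] := affine_frac (fun _ : 'I_1 => s) aU' U'x Ux.
exists (basic_open f), h; split=> //; rewrite rmorph0.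
apply: (invertible_mulIf iu); rewrite (uE ord0).
suff -> : a ord0 = 0 by rewrite rmorph0.
have fe := generic_in fx; have U'e := generic_in U'x.
apply: (affine_germ_eq0 (Ue := U'e)) => //.
rewrite -(germ_res U'e fe (@basic_open_sub _ _ _ f)) -uE rmorphM /=.
by rewrite (germ_res Ue fe h) g0 mulr0.
Qed.

Lemma germ_generic_inj U (Ue : U eta) : injective (germ Ue : O U -> stalk O eta).
Proof.
move=> s t e; apply/eqP; rewrite -subr_eq0; apply/eqP.
by apply: (germ_generic_eq0 (Ue := Ue)); rewrite rmorphB /= e subrr.
Qed.

Lemma generic_stalk_inv (a : stalk O eta) : a <> 0 -> invertible a.
Proof.
have [U [Ue aU]] := sch_affine eta.
have [u [b [iu uE]]] := affine_germ_frac Ue a aU => na.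
suff : invertible (germ Ue u * a) by rewrite invertibleM => -[].
rewrite uE; apply/basic_openP; apply: basic_open_generic => // b0; apply: na.
by apply: (invertible_mulIf iu); rewrite uE b0 rmorph0.
Qed.

Definition function_field : fieldType := field_of (@germ_neq1 eta) generic_stalk_inv.

Section Specialization.
Variable x : X.

(** A germ at x is a germ at eta, as every neighbourhood of x contains eta. The value is
    characterized for all representatives at once, which makes the chosen [generize] computable by
    [generizeE]. *)
Let generizeP (a : stalk O x) : exists b : stalk O eta,
  forall U (Ux : U x) (Ue : U eta) s, a = germ Ux s -> b = germ Ue s.
Proof.
have [U [Ux [s ->]]] := germP a; exists (germ (generic_in Ux) s).
move=> V Vx Ve t /germ_inj[W [h [k [Wx e]]]]; apply/germ_inj.
by exists W, h, k; split=> //; exact: generic_in Wx.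
Qed.

Definition generize (a : stalk O x) : function_field := projT1 (cid (generizeP a)).

Lemma generizeE U (Ux : U x) (Ue : U eta) s : generize (germ Ux s) = germ Ue s.
Proof. by rewrite /generize; case: cid => b /= bP; exact: bP. Qed.

Let generize_zmod : zmod_morphism generize.
Proof.
move=> a b; have [U [Ux [s [t [-> ->]]]]] := germP2 a b; have Ue := generic_in Ux.
by rewrite -rmorphB !(generizeE _ Ue) rmorphB.
Qed.

Let generize_monoid : monoid_morphism generize.
Proof.
split=> [|a b].
  rewrite -(rmorph1 (germ (I : opensT x))) (generizeE _ (I : opensT eta)).
  exact: rmorph1.
have [U [Ux [s [t [-> ->]]]]] := germP2 a b; have Ue := generic_in Ux.
by rewrite -rmorphM !(generizeE _ Ue) rmorphM.
Qed.

HB.instance Definition _ := GRing.isZmodMorphism.Build _ _ generize generize_zmod.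
HB.instance Definition _ := GRing.isMonoidMorphism.Build _ _ generize generize_monoid.

Lemma generize_inj : injective generize.
Proof.
move=> a b; have [U [Ux [s [t [-> ->]]]]] := germP2 a b; have Ue := generic_in Ux.
by rewrite !(generizeE _ Ue) => /germ_generic_inj ->.
Qed.

Lemma generize_frac : fractions_of generize.
Proof.
move=> y; have [U [Ux aU]] := sch_affine x; have Ue := generic_in Ux.
have [u [a [[v uv] uE]]] := affine_germ_frac Ue y aU.
have nz : (germ Ue u : function_field) != 0.
  by apply/eqP => u0; move: uv; rewrite u0 mul0r => /esym; exact: germ_neq1.
exists (germ Ux a), (germ Ux u); rewrite /= !(generizeE _ Ue); split=> //.
by rewrite -uE (mulrC (germ Ue u : function_field)) mulfK.
Qed.

End Specialization.

Lemma normal_integral_section U (Ue : U eta) (z : stalk O eta) :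
  normal_scheme X -> affine O U -> integral_over (germ Ue) z ->
  exists s : O U, germ Ue s = z.
Proof.
move=> nX aU [n [c zc]].
(* Normality lifts z to each stalk, and the lifts agree where they overlap     *)
(* because sections inject into the generic stalk.                            *)
have sec x : U x -> exists V (h : V `<=` U) (s : O V), V x /\ forall Ve, germ Ve s = z.
  move=> Ux; have [_ /(_ function_field (@generize x))] := nX x.
  move=> /(_ (@generize_inj x) (@generize_frac x) z)[].
    exists n, (fun i => germ Ux (c i)); rewrite -[RHS]zc; congr (_ + _).
    apply: eq_bigr => i _; congr (_ * _); exact: generizeE.
  move=> a ->; have [V [Vx [s ->]]] := germP a.
  exists (opensI U V), (@opensIl _ U V), (rres (@opensIr _ U V) s); split=> // We.
  exact: etrans (germ_res We.2 We _ s) (esym (generizeE Vx We.2 s)).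
have [|||s sE] := @mres_glue _ _ (struct_mod O) U
    (fun V h s => forall Ve, germ Ve (s : O V) = z).
- move=> V h s t sz tz; have [Ve|nVe] := pselect (V eta); last exact: empty_sections.
  by apply: (@germ_generic_inj V Ve); rewrite sz tz.
- move=> V h W k l s sz We; rewrite -(sz (k _ We)); exact: germ_res.
- by move=> x /sec[V [h [s [Vx sz]]]]; exists V, h; split=> //; exists s.
have [V [h [t [Ve tz]]]] := sec eta Ue; exists s; rewrite -(tz Ve) -(germ_res Ue Ve h).
by congr germ; exact: sE.
Qed.

End Integral.

End Scheme.

(** * Direct images under an isomorphism *)

Lemma prime_ideal_image (A B : comPzRingType) (phi : {rmorphism A -> B}) (P : set A) :
  injective phi -> (forall b, exists a, phi a = b) ->
  prime_ideal P -> prime_ideal (phi @` P).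
Proof.
move=> inj sur [[P0 PD PM] P1 prm].
have memE a : (phi @` P) (phi a) -> P a by case=> a' Pa' /inj <-.
split=> [||a b].
- split=> [|_ _ [a Pa <-] [b Pb <-]|b _ [a Pa <-]].
  + by exists 0 => //; rewrite rmorph0.
  + by exists (a + b); [exact: PD|rewrite rmorphD].
  + have [c <-] := sur b; exists (c * a); last by rewrite rmorphM.
    exact: PM.
- by rewrite -(rmorph1 phi) => /memE.
- have [c <-] := sur a; have [d <-] := sur b.
  by rewrite -rmorphM => /memE/prm[]; [left|right]; [exists c|exists d].
Qed.

Section AffineIso.
Variables (X Y : scheme) (nu : morphism Y X).
Local Notation pre := (Defs.preim (mor_cont nu)).
Local Notation OX := (str_sheaf X).
Local Notation OY := (str_sheaf Y).

Lemma basic_open_pull (U : opens X) (a : OX U) y :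
  basic_open (mor_pull nu U a) y <-> basic_open a (nu y).
Proof.
split=> [[Uy i]|[Uy i]]; first by exists Uy; exact: mor_local i.
have [V [h [Vy j]]] := invertible_germ i.
have pVy : pre V y by [].
have hV : pre V `<=` pre U by move=> z; exact: h.
exists (Uy : pre U y); rewrite -(germ_res (Uy : pre U y) pVy hV) -(mor_nat h).
by do 2! apply: invertible_morph.
Qed.

(** The form in which nu is known to be an isomorphism: X is covered by affine opens with affine
    preimage and the same ring. *)
Hypothesis iso_affine : forall x : X, exists U : opens X,
  [/\ U x, affine OX U, affine OY (pre U), injective (mor_pull nu U)
    & forall t, exists s, mor_pull nu U s = t].

(** The prime of x, carried to the ring upstairs, is the prime of a point y of the affine preimage.
    Then nu y and x have the same prime, hence coincide. *)
Lemma iso_surj x : exists y, nu y = x.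
Proof.
have [U [Ux aU aV inj sur]] := iso_affine x.
have pP := vanishing_prime Ux; case: aV => /(_ _ (prime_ideal_image inj sur pP)).
case=> y [[Vy yE] _] _ _; exists y; case: aU => /(_ _ pP)[z [_ zu]] _ _.
rewrite -(zu x) //; apply/esym/zu; split; first exact: Vy.
apply/seteqP; split=> f /= nf.
  have : [set t | ~ basic_open t y] (mor_pull nu U f) by move/basic_open_pull.
  by rewrite yE => -[g ng /inj <-].
have : [set t | ~ basic_open t y] (mor_pull nu U f) by rewrite yE; exists f.
by move=> + /basic_open_pull; apply.
Qed.

Lemma iso_nbhs y (V : opens Y) : V y ->
  exists W : opens X, W (nu y) /\ pre W `<=` V.
Proof.
move=> Vy; have [U [Uy aU aV inj sur]] := iso_affine (nu y).
have [g [gy gV]] := affine_basis aV (Uy : pre U y) Vy; have [f fg] := sur g.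
rewrite -fg in gy gV; exists (basic_open f); split; first exact/basic_open_pull.
by move=> z fz; apply: gV; exact/basic_open_pull.
Qed.

(** Turns local statements on Y into local statements on X; this is what makes nu_* preserve
    quasi-isomorphisms. *)
Lemma iso_nbhs_in x (U : opens X) (P : forall V : opens Y, V `<=` pre U -> Prop) :
  U x -> locally_on P -> exists (W : opens X) (V : opens Y) (h : V `<=` pre U),
    [/\ W x, W `<=` U, pre W `<=` V & P V h].
Proof.
move=> Ux lP; have [y yx] := iso_surj x; rewrite -yx in Ux *.
have [V [h [Vy PV]]] := lP y Ux; have [W [Wy hW]] := iso_nbhs Vy.
exists (opensI U W), V, h; split=> //; first exact: opensIl.
by move=> z [_ /hW].
Qed.

(** Injectivity is given only over U'. Near x, s is a / u on some D(f) with a defined on U'; the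
    pullback of a vanishes on the preimage of D(f), so a power of f kills a by localization upstairs
    and injectivity. *)
Lemma iso_pull_eq0 (U : opens X) (s : OX U) : mor_pull nu U s = 0 -> s = 0.
Proof.
move=> s0; apply: rres_ext => x Ux; have [U' [U'x aU aV inj sur]] := iso_affine x.
have [f [h [u [a [fx iu uE]]]]] := affine_frac (fun _ : 'I_1 => s) aU U'x Ux.
exists (basic_open f), h; split=> //; rewrite rmorph0.
apply: (invertible_mulIf iu); rewrite (uE ord0).
have hf : pre (basic_open f) `<=` pre U by move=> z; exact: h.
have sf : pre (basic_open f) `<=` pre U' by move=> z; exact: basic_open_sub.
have a0 : rres sf (mor_pull nu U' (a ord0)) = 0.
  by rewrite -(mor_nat (@basic_open_sub _ _ _ f)) -uE rmorphM (mor_nat h hf) s0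
    rmorph0 mulr0.
have l : basic_open (mor_pull nu U' f) `<=` pre (basic_open f).
  by move=> z /basic_open_pull.
have [|n] := affine_ker (f := mor_pull nu U' f) aV (a := mor_pull nu U' (a ord0)).
  by rewrite -(rres_comp sf l) a0 rmorph0.
rewrite -rmorphXn -rmorphM -(rmorph0 (mor_pull nu U')) => /inj e.
apply: (invertible_mulIf (a := rres (@basic_open_sub _ _ _ f) f ^+ n)).
  by apply: invertibleX; exact: affine_inv.
by rewrite -rmorphXn -rmorphM e rmorph0.
Qed.

(** On the preimage of D(f), t is a fraction b / f^n with b over the preimage of U'; there b is a
    pullback, and f is already a unit on D(f). *)
Lemma iso_pull_sur (U : opens X) (t : OY (pre U)) x : U x ->
  exists (W : opens X) (h : W `<=` U) (k : pre W `<=` pre U) s,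
    W x /\ rres k t = mor_pull nu W s.
Proof.
move=> Ux; have [U' [U'x aU aV inj sur]] := iso_affine x.
have [f [fx h]] := affine_basis aU U'x Ux.
have hf : pre (basic_open f) `<=` pre U by move=> z; exact: h.
have sf : pre (basic_open f) `<=` pre U' by move=> z; exact: basic_open_sub.
have l : pre (basic_open f) `<=` basic_open (mor_pull nu U' f).
  by move=> z fz; apply/basic_open_pull.
have l' : basic_open (mor_pull nu U' f) `<=` pre U.
  by move=> z /basic_open_pull; exact: h.
have [_ _ /(_ (mor_pull nu U' f))[_ frac _]] := aV.
have [n [b bE]] := frac (rres l' t); have [a ab] := sur b.
have [g gf] := invertibleX n (affine_inv f aU).
exists (basic_open f), h, hf, (g * rres (@basic_open_sub _ _ _ f) a); split=> //.
rewrite rmorphM (mor_nat _ sf) ab.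
have := congr1 (rres l) bE.
rewrite rmorphM rmorphXn !(rres_comp _ l sf) (rres_comp l' l hf).
move=> <-; rewrite -(mor_nat (@basic_open_sub _ _ _ f)) -rmorphXn mulrA -rmorphM.
by rewrite (mulrC g) gf rmorph1 mul1r.
Qed.

Definition push_chain (K L : complex OY) (f : chainMap K L) :
  chainMap (push_cx nu K) (push_cx nu L) :=
  @ChainMap X OX (push_cx nu K) (push_cx nu L) (fun i => push_hom nu (f i))
    (fun i U => @cm_d _ _ _ _ f i (pre U)).

Lemma boundary_push (K : complex OY) i (U : opens X) (s : K (i + 1) (pre U)) :
  @boundary _ _ (push_cx nu K) i U s <-> boundary s.
Proof.
split=> bs.
  move=> y Uy; have [V [h [Vy [t e]]]] := bs (nu y) Uy.
  by exists (pre V), (preimS h); split=> //; exists t.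
move=> x Ux; have [W [V [h [Wx WU WV [t e]]]]] := iso_nbhs_in Ux bs.
exists W, WU; split=> //; exists (mres WV t : push_mod nu (K i) W).
by rewrite /= hom_nat e; exact: mres_comp.
Qed.

Lemma quasi_iso_push (K L : complex OY) (f : chainMap K L) :
  quasi_iso f -> quasi_iso (push_chain f).
Proof.
move=> /quasi_isoP[fi fs]; apply/quasi_isoP; split=> i U s ds.
  by move=> /boundary_push bs; apply/boundary_push; exact: fi.
move=> x Ux; have [W [V [h [Wx WU WV [t [dt bt]]]]]] := iso_nbhs_in Ux (fs i _ s ds).
exists W, WU; split=> //; exists (mres WV t : push_mod nu (K (i + 1)) W).
split; first by rewrite /= hom_nat dt mres0.
apply/boundary_push; move: (boundary_res WV bt).
by rewrite mresB -hom_nat (mres_comp h WV (preimS WU)).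
Qed.

Lemma pull_lin (U : opens X) :
  linear (mor_pull nu U : struct_mod OX U -> push_mod nu (struct_mod OY) U).
Proof. by move=> a s t; rewrite rmorphD rmorphM. Qed.

Definition pull_hom : modHom (struct_mod OX) (push_mod nu (struct_mod OY)) :=
  ModHom pull_lin (fun U V h s => mor_nat h (preimS h) s).

(** The match is on the Boolean that selects the components of [single], so that source and target
    reduce together. *)
Definition pull_single (i : int) :
    modHom (single (struct_mod OX) i) (push_mod nu (single (struct_mod OY) i)) :=
  match i == 0 as b return
    modHom (if b then struct_mod OX else zero_mod OX)
      (push_mod nu (if b then struct_mod OY else zero_mod OY)) with
  | true => pull_hom
  | false => hom_zero _ _
  end.

Program Definition pull_chain :
    chainMap (single (struct_mod OX)) (push_cx nu (single (struct_mod OY))) :=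
  @ChainMap X OX (single (struct_mod OX)) (push_cx nu (single (struct_mod OY)))
    pull_single _.
Next Obligation. by move=> i U s; rewrite [LHS]hom0. Qed.

Lemma pull_single_eq0 i U (s : single (struct_mod OX) i U) :
  pull_single i U s = 0 -> s = 0.
Proof.
move: s; rewrite /pull_single /=; case: (i == 0) => s; first exact: iso_pull_eq0.
by rewrite [s]thinmx0.
Qed.

Lemma pull_single_sur i U (t : push_mod nu (single (struct_mod OY) i) U) :
  locally_on (fun V (h : V `<=` U) => exists s, pull_single i V s = mres h t).
Proof.
move: t; rewrite /pull_single /=; case: (i == 0) => t x Ux.
  have [W [h [k [s [Wx e]]]]] := iso_pull_sur t Ux; exists W, h; split=> //.
  by exists s; rewrite /= -e; exact: rres_irr.
exists U, (fun _ => id); split=> //; exists 0; rewrite hom0.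
by rewrite [LHS](thinmx0 (_ : 'rV_0)) [RHS](thinmx0 (_ : 'rV_0)).
Qed.

Lemma boundary_d0 (Z : topologicalType) (O : ringSheaf Z) (K : complex O) i U
    (s : K (i + 1) U) :
  (forall U (t : K i U), cx_d K i U t = 0) -> boundary s -> s = 0.
Proof.
move=> d0 bs; apply: mres_ext => x Ux; have [V [h [Vx [t]]]] := bs x Ux.
by rewrite d0 => e; exists V, h; split=> //; rewrite -e mres0.
Qed.

(** All differentials on both sides vanish, so it suffices that each component is injective and
    locally surjective. *)
Lemma quasi_iso_pull : quasi_iso pull_chain.
Proof.
apply/quasi_isoP; split=> i U s ds.
  move/boundary_d0 => /(_ (fun _ _ => erefl)) /pull_single_eq0 ->.
  exact: boundary0.
move=> x Ux; have [V [h [Vx [t e]]]] := pull_single_sur s Ux.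
exists V, h; split=> //; exists t; split=> //.
by rewrite -e subrr; exact: boundary0.
Qed.

End AffineIso.

(** * Coherence of the structure sheaf *)

Section Coherence.
Variables (X : topologicalType) (O : ringSheaf X).

Lemma coherent_zero_mod : coherent (zero_mod O).
Proof.
split=> [x|U n s x Ux].
  exists opensT, 0%N, (fun=> 0); split=> // V h t y Vy; exists V, (fun _ => id).
  by split=> //; exists (fun=> 0); rewrite [LHS](thinmx0 (_ : 'rV_0)) big_ord0.
(* Every tuple is a relation in the zero module, so the unit vectors generate the relations. *)
exists U, (fun _ => id); split=> //; exists n, (fun j i => (i == j)%:R).
split=> [j|W k t _ y Wy]; first exact: thinmx0.
exists W, (fun _ => id); split=> //; exists t => i.
rewrite rres_id (bigD1 i) //= eqxx !rmorph1 mulr1 big1 ?addr0 // => j ji.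
by rewrite eq_sym (negbTE ji) !rmorph0 mulr0.
Qed.

(** On D(f) the s_i are a_i / u, so their relations are those of the a_i. Over O(U') the latter form
    a finitely generated module. A relation t over a smaller open is locally b / u' on some D(f'),
    and some f'^N b is a relation over O(U'), hence a combination of the generators; dividing by the
    unit f'^N u' recovers t. *)
Lemma coherent_struct_mod :
  (forall x : X, exists U : opens X, [/\ U x, affine O U & noetherian_ring (O U)]) ->
  coherent (struct_mod O).
Proof.
move=> nX; split=> [x|U n s x Ux].
  exists opensT, 1%N, (fun=> 1); split=> // V h t y Vy; exists V, (fun _ => id).
  split=> //; exists (fun=> t); rewrite big_ord1 /= !rmorph1 rres_id.
  exact: (esym (mulr1 t)).
have [U' [U'x aU' nU']] := nX x.
have [f [h [u [a [fx iu uE]]]]] := affine_frac s aU' U'x Ux.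
pose sf := @basic_open_sub _ _ _ f.
have [||m [r [ra rgen]]] := noetherian_submodule
    (S := [set t : 'I_n -> O U' | \sum_(i < n) t i * a i = 0]) nU'.
- by rewrite /= big1 // => i _; rewrite mul0r.
- move=> c t t' /= t0 t0'; under eq_bigr do rewrite mulrDl -mulrA.
  by rewrite big_split -mulr_sumr /= t0 t0' mulr0 addr0.
exists (basic_open f), h; split=> //; exists m, (fun j i => rres sf (r j i)).
split=> [j|W k t t0 y Wy].
  change (\sum_(i < n) rres sf (r j i) * rres h (s i) = 0).
  apply: (invertible_mulIf iu); rewrite mulr_sumr.
  transitivity (rres sf (\sum_(i < n) r j i * a i)); last first.
    by rewrite [X in rres _ X]ra rmorph0.
  by rewrite rmorph_sum; apply: eq_bigr => i _; rewrite rmorphM -uE mulrCA.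
have U'y : U' y by exact: basic_open_sub (k _ Wy).
have [f' [l [u' [b [fy iu' uE']]]]] := affine_frac t aU' U'y Wy.
pose sf' := @basic_open_sub _ _ _ f'.
have [|N ba] := affine_ker (f := f') (a := \sum_(i < n) b i * a i) aU'.
  rewrite -/sf'; have -> : rres sf' (\sum_(i < n) b i * a i) =
      rres sf' (u' * u) * rres l (\sum_(i < n) t i * rres k (rres h (s i))).
    rewrite !rmorph_sum mulr_sumr; apply: eq_bigr => i _.
    rewrite !rmorphM -uE' mulrACA; congr (_ * _).
    rewrite -(rres_comp sf (subset_trans l k) sf') -uE rmorphM.
    by rewrite (rres_comp sf _ sf') (rres_comp k l (subset_trans l k)).
  by rewrite [\sum_(i < n) _]t0 rmorph0 mulr0.
have [|c cE] := rgen (fun i => f' ^+ N * b i).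
  by rewrite /=; under eq_bigr do rewrite -mulrA; rewrite -mulr_sumr ba.
have [g gE] : invertible (rres sf' (f' ^+ N * u')).
  rewrite rmorphM rmorphXn invertibleM; split=> //.
  by apply: invertibleX; exact: affine_inv.
exists (basic_open f'), l; split=> //; exists (fun j => g * rres sf' (c j)) => i.
rewrite -[LHS]mul1r -gE rmorphM (mulrC (_ * _) g) -!mulrA uE' -rmorphM cE.
rewrite rmorph_sum mulr_sumr; apply: eq_bigr => j _.
by rewrite rmorphM mulrA (rres_comp k l (subset_trans l k)) (rres_comp sf _ sf').
Qed.

Lemma Dbcoh_single_struct_mod :
  coherent (struct_mod O) -> Dbcoh (single (struct_mod O)).
Proof.
move=> cO; have zero (i : int) : i + 1 != 0 ->
    forall U (s : single (struct_mod O) (i + 1) U), s = 0.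
  by rewrite /single /= => /negbTE -> U s; rewrite [s]thinmx0.
split.
  (* The bound 2 excludes i = -1, the only index with i + 1 = 0. *)
  exists 2 => i U s i2 _; rewrite (zero i _ U s); first exact: boundary0.
  by apply/eqP => /(canRL (addrK 1)) i1; rewrite i1 in i2.
move=> i; have [i0|i0] := eqVneq (i + 1) 0; last first.
  exists (zero_mod O); split; last exact: coherent_zero_mod.
  apply/is_cohomologyP; exists (fun _ _ => 0).
  split=> [U a s t _ _|U V h s _|U t x Ux|U s _].
  - by rewrite scaler0 addr0.
  - by rewrite mres0.
  - by exists U, (fun _ => id); split=> //; exists 0.
  - by rewrite (zero i i0 U s); split=> // _; exact: boundary0.
exists (struct_mod O); split=> //; apply/is_cohomologyP.
(* The component in degree i + 1 is O only after rewriting i + 1 = 0 in its type; this isolates a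
   statement in which the rewriting is possible, with the identity as witness. *)
suff [p [lin nat bij]] : exists p : forall U, single (struct_mod O) (i + 1) U -> O U,
    [/\ forall U, linear (p U : _ -> (struct_mod O U)),
      forall (U V : opens X) (h : V `<=` U) s, p V (mres h s) = rres h (p U s)
    & forall U t, exists s, p U s = t /\ forall s', p U s' = t -> s' = s].
  exists p; split=> [U a s t _ _|U V h s _|U t x Ux|U s _].
  - exact: lin.
  - exact: nat.
  - exists U, (fun _ => id); split=> //; have [s [sE _]] := bij U t.
    by exists s; rewrite sE mres_id.
  - have [s0 [p0 uniq0]] := bij U 0.
    have pz : p U 0 = 0.
      by move: (lin U (-1) 0 0); rewrite scaler0 addr0 scaleN1r addNr.
    split=> [/uniq0 ->|bs]; first by rewrite -(uniq0 _ pz); exact: boundary0.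
    by rewrite (boundary_d0 _ bs).
rewrite /single /= i0 eqxx; exists (fun U s => s); split=> // U t.
by exists t.
Qed.

End Coherence.

(** * Normalization *)

(** Multiplication by the unit phi(b)^n clears denominators. The homogeneous equation lives in A, so
    an integral equation for a / b can be moved from one ring of fractions to another. *)
Lemma homogenize_integral (A B : comPzRingType) (phi : {rmorphism A -> B})
    n (c : 'I_n -> A) (a b : A) (d : B) : phi b * d = 1 ->
  (phi a * d) ^+ n + \sum_(i < n) phi (c i) * (phi a * d) ^+ i = 0 <->
  phi (a ^+ n + \sum_(i < n) c i * a ^+ i * b ^+ (n - i)) = 0.
Proof.
move=> bd.
have -> : phi (a ^+ n + \sum_(i < n) c i * a ^+ i * b ^+ (n - i)) =
    phi b ^+ n * ((phi a * d) ^+ n + \sum_(i < n) phi (c i) * (phi a * d) ^+ i).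
  rewrite rmorphD rmorph_sum mulrDr mulr_sumr rmorphXn; congr (_ + _).
    by rewrite -exprMn mulrCA bd mulr1.
  apply: eq_bigr => i _; rewrite !rmorphM !rmorphXn [RHS]mulrCA -[LHS]mulrA.
  congr (_ * _).
  rewrite -[X in phi b ^+ X * _](subnK (ltnW (ltn_ord i))) exprD -[RHS]mulrA.
  rewrite -exprMn mulrCA bd mulr1.
  exact: mulrC.
split=> [->|]; first by rewrite mulr0.
by apply: invertible_mulIf; apply: invertibleX; exists d.
Qed.

(** The section y acts on each term and commutes with the differentials, so a s = b (y s) holds
    exactly, already for cocycles. *)
Lemma coho_div_push (X Y : scheme) (nu : morphism Y X) (U : opens X)
    (a b : str_sheaf X U) (y : str_sheaf Y (Defs.preim (mor_cont nu) U))
    (K : complex (str_sheaf Y)) :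
  mor_pull nu U b * y = mor_pull nu U a -> coho_div a b (push_cx nu K).
Proof.
move=> by_a i V h s ds x Vx; exists V, (fun _ => id); split=> //.
pose y' := rres (preimS h) y.
exists ((y' *: (s : K (i + 1) (Defs.preim (mor_cont nu) V))) : push_mod nu (K (i + 1)) V).
split; first by rewrite /= homZ [cx_d K _ _ _]ds scaler0.
rewrite mres_id; set s' := _ - _; suff -> : s' = 0 by exact: boundary0.
rewrite /s' !(rres_irr _ h); apply/eqP; rewrite subr_eq0; apply/eqP.
change (mor_pull nu V (rres h a) *: (s : K (i + 1) (Defs.preim (mor_cont nu) V)) =
  mor_pull nu V (rres h b) *: (y' *: (s : K (i + 1) (Defs.preim (mor_cont nu) V)))).
by rewrite scalerA !(mor_nat h (preimS h)) -rmorphM by_a.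
Qed.

Lemma coho_div_struct_mod (X : topologicalType) (O : ringSheaf X) (U : opens X)
    (a b : O U) x (Ux : U x) :
  coho_div a b (single (struct_mod O)) -> exists c, germ Ux a = germ Ux b * c.
Proof.
(* The index -1 selects degree 0, where divisibility is applied to the cocycle 1. *)
move=> /(_ (-1) U (fun _ => id) (1 : O U) erefl x Ux)[W [k [Wx [t [_ /boundary_d0 bt]]]]].
have {bt} /eqP := bt (fun _ _ => erefl); rewrite subr_eq0 => /eqP e.
exists (germ Wx (t : O W)); rewrite -!(germ_res Ux Wx k) -rmorphM; congr germ.
rewrite !(rres_irr _ k) in e; rewrite -[LHS]mulr1 -(rmorph1 (rres k)).
exact: e.
Qed.

(** Two cases, since the minimum defining [level] may be 0. *)
Lemma level_le1 (X : topologicalType) (O : ringSheaf X) (T : complex O -> Prop)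
    (G E : complex O) :
  level_le (level T G E) 1 <-> generated T G 0 E \/ generated T G 1 E.
Proof.
rewrite /level; case: pselect => [ex|nex] /=.
  case: ex_minnP => m /asboolP gm min; split.
    by case: m gm {min} => [|[]//]; [left|right].
  by case=> g; [apply: (@leq_trans 0)|]; rewrite // min //; exact/asboolP.
by split=> // -[g|g]; exfalso; apply: nex; [exists 0%N|exists 1%N]; exact/asboolP.
Qed.

Section Normalization.
Variables (X Y : scheme) (nu : morphism Y X).
Hypotheses (X_int : integral_scheme X) (nu_norm : is_normalization nu).
Local Notation O := (str_sheaf X).

(** Sections over the preimage of U are the elements of the function field integral over O(U); for
    normal X these already are sections over U. *)
Lemma normal_iso_affine : normal_scheme X -> forall x : X, exists U : opens X,
  [/\ U x, affine O U, affine (str_sheaf Y) (Defs.preim (mor_cont nu) U),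
      injective (mor_pull nu U)
    & forall t, exists s, mor_pull nu U s = t].
Proof.
move=> nX x; have [eta [dense norm]] := nu_norm.
have [U [Ux aU]] := sch_affine x; have Ue := generic_in dense Ux.
have [aV [j [jinj jE jrng]]] := norm U Ue aU; exists U; split=> //.
  move=> a b e; apply: (germ_generic_inj X_int dense (Ue := Ue)).
  by rewrite -!jE e.
move=> t; have : range j (j t) by exists t.
rewrite jrng => /(normal_integral_section X_int dense nX aU)[s sE].
by exists s; apply: jinj; rewrite jE.
Qed.

Lemma normal_of_coho_div :
  (forall (U : opens X) (a b : O U) y, mor_pull nu U b * y = mor_pull nu U a ->
     coho_div a b (single (struct_mod O))) ->
  normal_scheme X.
Proof.
move=> div x; split=> [|K phi phi_inj frac y [n [c yc]]]; first exact: integral_stalk.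
have [eta [dense norm]] := nu_norm.
have [U [Ux aU]] := sch_affine x; have Ue := generic_in dense Ux.
have [aV [j [jinj jE jrng]]] := norm U Ue aU.
have [al [be [be0 yE]]] := frac y.
(* With a common denominator w of al, be and the c i in the stalk at x, w y    *)
(* is a fraction of sections over U that is integral over O U.                *)
have [w [e [iw eE]]] := affine_germ_common Ux
  (fun i : 'I_n.+2 => if unlift ord0 i is Some k then
     (if unlift ord0 k is Some l then c l else al) else be) aU.
pose psi : {rmorphism O U -> K} := phi \o germ Ux.
have w0 : psi w != 0.
  have [v wv] := iw; apply/eqP => pw0; have /eqP := congr1 phi wv.
  by rewrite rmorphM [phi _]pw0 mul0r rmorph1 eq_sym oner_eq0.
pose b := e ord0; pose a := e (lift ord0 ord0).
have bE : psi b = psi w * phi be.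
  by have := congr1 phi (eE ord0); rewrite unlift_none rmorphM.
have aE : psi a = psi w * phi al.
  by have := congr1 phi (eE (lift ord0 ord0)); rewrite liftK unlift_none rmorphM.
pose e' (i : 'I_n) := e (lift ord0 (lift ord0 i)).
have cE i : psi (e' i) = psi w * phi (c i).
  by have := congr1 phi (eE (lift ord0 (lift ord0 i))); rewrite !liftK rmorphM.
have b0 : psi b != 0 by rewrite bE mulf_neq0.
have yab : psi (w * a) * (psi b)^-1 = psi w * y.
  by rewrite rmorphM aE bE yE invfM -!mulrA (mulrCA (phi al)) mulVKf.
(* The equation for w y has coefficients w^(n-i) c_i; one factor w is absorbed in e'_i, which
   represents w c_i. *)
pose d (i : 'I_n) := e' i * w ^+ (n - i.+1).
have homog : (w * a) ^+ n + \sum_(i < n) d i * (w * a) ^+ i * b ^+ (n - i) = 0.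
  suff g0 : germ Ux ((w * a) ^+ n + \sum_(i < n) d i * (w * a) ^+ i * b ^+ (n - i)) = 0.
    have [W [h [Wx W0]]] := (germ_eq0 _ _).1 g0.
    apply: (germ_generic_eq0 X_int dense (Ue := Ue)).
    by apply/germ_eq0; exists W, h; split=> //; exact: generic_in Wx.
  apply: phi_inj; rewrite rmorph0; move: (divff b0) => bb.
  apply/(homogenize_integral (phi := psi) d (w * a) bb); rewrite yab.
  have := congr1 ( *%R (psi w ^+ n)) yc.
  rewrite mulr0 mulrDr mulr_sumr exprMn => yc'; rewrite -[RHS]yc'; congr (_ + _).
  apply: eq_bigr => i _; rewrite rmorphM rmorphXn cE exprMn.
  rewrite -[X in _ = psi w ^+ X * _](subnK (ltn_ord i)) exprD exprS; ring.
have [|v bv] := @generic_stalk_inv _ _ X_int dense (germ Ue b).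
  move=> gb0; move: b0; rewrite (germ_generic_eq0 X_int dense gb0).
  by rewrite rmorph0 eqxx.
(* The same homogeneous equation, read in the function field, shows that w a / b is integral over
   O(U), hence a section z over the preimage of U. *)
have : range j (germ Ue (w * a) * v).
  by rewrite jrng; exists n, d; apply/(homogenize_integral d _ bv); rewrite homog rmorph0.
case=> z _ zE; have bz : mor_pull nu U b * z = mor_pull nu U (w * a).
  by apply: jinj; rewrite rmorphM zE !jE mulrCA bv mulr1.
(* Thus w y = w a / b is the element g of the stalk, and w is a unit there. *)
have [g gE] := coho_div_struct_mod Ux (div _ _ _ _ bz).
have [v' wv'] := iw; exists (g * v'); apply: (mulfI w0).
rewrite -yab [psi (w * a)](congr1 phi gE) !rmorphM mulrAC mulfV // mul1r.
have pw : psi w * phi v' = 1 by rewrite -[psi w]/(phi (germ Ux w)) -rmorphM wv' rmorph1.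
by rewrite mulrCA pw mulr1.
Qed.

End Normalization.

Theorem theorem2 (X Xnu : scheme) (nu : morphism Xnu X)
    (G : complex (str_sheaf X))
    (X_integral : integral_scheme X)
    (X_noetherian : noetherian_scheme X)
    (X_nagata : nagata_scheme X)
    (nu_normalization : is_normalization nu)
    (G_push : is_derived_push nu (single (struct_mod (str_sheaf Xnu))) G) :
  normal_scheme X <->
  level_le (level (@Dbcoh X (str_sheaf X)) G (single (struct_mod (str_sheaf X)))) 1.
Proof.
have [I [eps [eps_qis _ _ IG]]] := G_push; rewrite level_le1; split=> [nX|gen].
  right; have iso := normal_iso_affine X_integral nu_normalization nX.
  have OI : derived_iso (single (struct_mod (str_sheaf X))) (push_cx nu I).
    apply: quasi_iso_derived (cm_comp (push_chain nu eps) (pull_chain nu)) _.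
    have [pi ps] := (quasi_isoP _).1 (quasi_iso_push iso eps_qis).
    have [ui us] := (quasi_isoP _).1 (quasi_iso_pull iso).
    apply/quasi_isoP; split; first exact: coho_inj_comp.
    exact: coho_surj_comp.
  apply: add_iso (derived_iso_sym OI) _; apply: add_iso (derived_iso_sym IG) _.
  (* [add_in] requires G to have bounded coherent cohomology, which it inherits from O_X along the
     two isomorphisms. *)
  apply: add_in => //; apply: Dbcoh_derived_iso IG _; apply: Dbcoh_derived_iso OI _.
  apply: Dbcoh_single_struct_mod; apply: coherent_struct_mod.
  by case: X_noetherian.
apply: (normal_of_coho_div X_integral nu_normalization) => U a b y ya.
case: gen => /coho_div_add; apply=> _ ->; first exact: coho_div_zero.
exact: (coho_div_derived_iso IG) (coho_div_push ya).
Qed.
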